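(* Let $T$ be a rooted, chain complete tree. The following are equivalent. (i) $(T,\tau_{\mathrm{cw}})$ is a weakly Corson compact space. (ii) $(T,\tau_{\sigma\text{-cw}})$ is a Corson countably compact space. (iii) $(\hat{T},\tau_{\mathrm{cw}})$ is a Valdivia compact space.
   Context: All topological spaces are assumed Hausdorff and completely regular. Trees. A tree is a partially ordered set $(T,\leq)$ such that for every $t\in T$ the set $\{s\in T: s<t\}$ is well-ordered by $<$. It is rooted if it has exactly one minimal element, and chain complete if every chain (totally ordered subset) has a supremum. For $t\in T$, $\mathrm{ht}(t,T)$ is the order type of $\{s\in T: s<t\}$, and $\mathrm{cf}(t)$ (or $\mathrm{cf}(t,T)$) is the cofinality of $\mathrm{ht}(t,T)$, with the convention $\mathrm{cf}(t)=0$ if $\mathrm{ht}(t,T)$ is $0$ or a successor ordinal. Put $I(T)=\{t\in T:\mathrm{cf}(t)<\omega\}$ and $V_t=\{s\in T: s\geq t\}$. Topologies. The coarse wedge topology $\tau_{\mathrm{cw}}$ on a tree $T$ is the topology whose subbase consists of the sets $V_t$ and $T\setminus V_t$ with $t\in I(T)$; it is compact Hausdorff when $T$ is rooted and chain complete. The countably coarse wedge topology $\tau_{\sigma\text{-cw}}$ on $T$ is the topology whose subbase consists of all sets $V_t$ and $T\setminus V_t$ with $t\in T$, $\mathrm{cf}(t)\neq\omega$. The tree $\hat{T}$. $\hat{T}$ is the tree obtained from $T$ by adding, for each $t\in T$ with $\mathrm{cf}(t,T)\geq\omega_1$, a single new point $s(t)$ placed between $t$ and its predecessors $\{r\in T: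 r<t\}$. Explicitly, $\hat{T}=T\sqcup\{s(t): t\in T,\ \mathrm{cf}(t,T)\geq\omega_1\}$, with the order extending that of $T$ such that, for $r\in T$: $r\leq s(t)$ iff $r<t$; $s(t)\leq r$ iff $t\leq r$; and $s(t)\leq s(t')$ iff $t\leq t'$. (If $T$ has no element with $\mathrm{cf}(t,T)\geq\omega_1$, then $\hat T=T$.) Compacta. For a set $\Gamma$, let $\Sigma(\Gamma)=\{x\in[0,1]^\Gamma: |\{\gamma\in\Gamma: x(\gamma)\neq0\}|\leq\omega\}$, where $[0,1]^\Gamma$ has the product topology. A compact space $K$ is Valdivia if there are a set $\Gamma$ and a homeomorphic embedding $h:K\to[0,1]^\Gamma$ such that $h^{-1}(\Sigma(\Gamma))$ is dense in $K$. A space is countably compact if every countable open cover has a finite subcover. A space is a Corson countably compact if it is homeomorphic to a countably compact subset of $\Sigma(\Gamma)$ for some set $\Gamma$. A compact space is weakly Corson if it is a continuous image of a Corson countably compact space. *)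

(* Defs.v *)
From HB Require Import structures.
From mathcomp Require Import all_boot all_order all_algebra.
From mathcomp Require Import all_classical all_reals all_analysis.
From mathcomp Require Import wochoice.

Set Implicit Arguments.
Unset Strict Implicit.
Unset Printing Implicit Defensive.

Import Order.TTheory GRing.Theory Num.Theory.
Import numFieldNormedType.Exports.

Local Open Scope classical_set_scope.
Local Open Scope order_scope.
Local Open Scope card_scope.

Section Trees.
Context {d : Order.disp_t} (T : porderType d).
Implicit Types (s t : T) (A C K : set T).

Definition is_tree := forall t, wo_chain <=%O [pred s : T | s < t].

Definition rooted := exists! r : T, minimal <=%O r.

Definition chain_complete :=
  forall A, total_on A (fun x y => x <= y) -> exists m, isLub A m.

End Trees.

Section Cofinality.
Context {d : Order.disp_t} {T : porderType d}.
Implicit Types (s t : T) (C K : set T).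

Definition predecessors t : set T := [set s | s < t].

(* In a tree, this says that ht(t, T) is a nonzero limit ordinal. *)
Definition limit_height t :=
  predecessors t !=set0 /\
  ~ exists2 m, predecessors t m & ubound (predecessors t) m.

Definition cofinal_below t C :=
  C `<=` predecessors t /\ forall s, s < t -> exists2 c, C c & s <= c.

(* cf(t) = |K|: the cofinality, a cardinal, is represented by a cofinal set of
   least cardinality, or by the empty set when ht(t, T) is 0 or a successor.
   Thus cf_finite t says cf(t) < omega, cf_omega t says cf(t) = omega and
   cf_uncountable t says cf(t) >= omega_1. *)
Definition represents_cf t K :=
  (limit_height t ->
     cofinal_below t K /\ forall C, cofinal_below t C -> K #<= C) /\
  (~ limit_height t -> K = set0).

Definition cf_finite t := exists2 K, represents_cf t K & finite_set K.

Definition cf_omega t := exists2 K, represents_cf t K & K #= [set: nat].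

Definition cf_uncountable t := exists2 K, represents_cf t K & ~ countable K.

Definition wedge t : set T := [set s | t <= s].

Definition wedge_subbase (P : set T) : set (set T) :=
  [set U | exists2 t, P t & U = wedge t \/ U = ~` wedge t].

End Cofinality.

Definition coarse_wedge {d} (T : porderType d) : Type := T.
Definition sigma_coarse_wedge {d} (T : porderType d) : Type := T.

HB.instance Definition _ d (T : porderType d) :=
  Choice.copy (coarse_wedge T) T.
HB.instance Definition _ d (T : porderType d) :=
  isSubBaseTopological.Build (coarse_wedge T)
    (wedge_subbase [set t : T | cf_finite t]) id.

HB.instance Definition _ d (T : porderType d) :=
  Choice.copy (sigma_coarse_wedge T) T.
HB.instance Definition _ d (T : porderType d) :=
  isSubBaseTopological.Build (sigma_coarse_wedge T)
    (wedge_subbase [set t : T | ~ cf_omega t]) id.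

Section Hat.
Context {d : Order.disp_t} (T : porderType d).

(* hat_sep t _ is the new point s(t). *)
Inductive hat :=
  | hat_base of T
  | hat_sep (t : T) of cf_uncountable t.

Definition hat_le (x y : hat) : bool :=
  match x, y with
  | hat_base r, hat_base r' => r <= r'
  | hat_base r, hat_sep t _ => r < t
  | hat_sep t _, hat_base r => t <= r
  | hat_sep t _, hat_sep t' _ => t <= t'
  end.

Lemma hat_le_refl : reflexive hat_le.
Proof. by case=> [r|t h] /=. Qed.

Lemma hat_le_anti : antisymmetric hat_le.
Proof.
case=> [r|t h] [r'|t' h'] /= /andP[].
- by move=> a b; congr hat_base; apply/le_anti; rewrite a b.
- by move=> a /(lt_le_trans a); rewrite ltxx.
- by move=> a b; move: (le_lt_trans a b); rewrite ltxx.
- move=> a b; have e : t = t' by apply/le_anti; rewrite a b.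
  by subst t'; congr hat_sep; exact: Prop_irrelevance.
Qed.

Lemma hat_le_trans : transitive hat_le.
Proof.
case=> [y|y ?] [x|x ?] [z|z ?] /= xy yz;
  first [ exact: le_trans xy yz | exact: le_lt_trans xy yz
        | exact: lt_le_trans xy yz | exact: ltW (le_lt_trans xy yz)
        | exact: ltW (lt_le_trans xy yz) ].
Qed.

End Hat.

HB.instance Definition _ d (T : porderType d) := gen_eqMixin (hat T).
HB.instance Definition _ d (T : porderType d) := gen_choiceMixin (hat T).
HB.instance Definition _ d (T : porderType d) :=
  Order.Le_isPOrder.Build d (hat T)
    (@hat_le_refl d T) (@hat_le_anti d T) (@hat_le_trans d T).

Section Compacta.

Definition embedding (X Y : topologicalType) (f : X -> Y) :=
  injective f /\
  forall U : set X, open U <-> exists2 V : set Y, open V & f @^-1` V = U.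

Definition homeomorphic (X Y : topologicalType) :=
  exists f : X -> Y, exists g : Y -> X,
    [/\ cancel f g, cancel g f, continuous f & continuous g].

Definition countably_compact (X : topologicalType) (A : set X) :=
  forall (D : set nat) (U : nat -> set X),
    (forall i, D i -> open (U i)) -> A `<=` cover D U ->
    finite_subset_cover D U A.

Context (R : realType).
Local Open Scope ring_scope.

Definition cube (G : Type) : set {ptws G -> R} :=
  [set x | forall g, 0 <= x g <= 1].

Definition Sigma (G : Type) : set {ptws G -> R} :=
  [set x | cube x /\ countable [set g | x g != 0]].

Definition valdivia_compact (K : topologicalType) :=
  compact [set: K] /\
  exists (G : Type) (h : K -> {ptws G -> R}),
    [/\ embedding h, range h `<=` @cube G & dense (h @^-1` @Sigma G)].

(* A is regarded as a space with its subspace topology. *)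
Definition corson_countably_compact (X : topologicalType) :=
  exists (G : Type) (A : set {ptws G -> R}),
    [/\ A `<=` @Sigma G, countably_compact A & homeomorphic X (set_type A)].

(* L is Hausdorff and completely regular since it embeds in a cube, and K is
   completely regular since it is compact Hausdorff. *)
Definition weakly_corson_compact (K : topologicalType) :=
  [/\ compact [set: K], hausdorff_space K &
    exists (L : topologicalType) (f : L -> K),
      [/\ corson_countably_compact L, continuous f & range f = [set: K]]].

End Compacta.

(* Main.v *)
Require Import Defs.
From HB Require Import structures.
From mathcomp Require Import all_boot all_order all_algebra.
From mathcomp Require Import all_classical all_reals all_analysis.
From mathcomp Require Import wochoice lra.

Set Implicit Arguments.
Unset Strict Implicit.
Unset Printing Implicit Defensive.

Import Order.TTheory GRing.Theory Num.Theory.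
Import numFieldNormedType.Exports.

Local Open Scope classical_set_scope.
Local Open Scope order_scope.
Local Open Scope card_scope.

(** Call a node of [T] clopen when its cofinality is not omega. The wedges of the
    clopen nodes generate the countably coarse wedge topology on [T]. They also
    generate the coarse wedge topology of [hat T], where a node of uncountable
    cofinality has become the successor of the new point below it. So [hat T] is a
    compact space containing the countably coarse [T] as a dense subspace.

    From Valdivia to weakly Corson ([valdivia_weakly_corson]): the points of
    [hat T] sent into the Sigma-product are closed under limits of sequences. Each
    point of [T] is the limit of a sequence from any dense subset of [hat T]
    ([trace_frechet]), so all of [T] is sent into the Sigma-product, and collapsing
    the new points maps that countably compact set continuously onto [T].

    From Corson to Valdivia ([corson_valdivia]): a continuous real function on the
    countably coarse [T] is constant just below each limit of uncountable
    cofinality ([eventually_constant]), because a failure would produce sequences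
    branching off towards a limit of cofinality omega. Hence an embedding of [T]
    into a Sigma-product extends to [hat T]. It stays injective since disjoint
    relatively clopen pieces of a countably compact subset of a Sigma-product have
    disjoint closures in the cube ([rel_clopen_disjoint_closure]).

    From weakly Corson to Corson ([weakly_corson_corson]) is the main part. Let
    [A] be a countably compact subset of a Sigma-product and [f] a continuous map
    of [A] onto the coarse [T]. Sigma-products are Frechet, so the preimage of the
    wedge of a node of uncountable cofinality is clopen as well
    ([f_clopen_node]), and [f] is continuous for the countably coarse topology.
    It remains to find a point-countable family of clopen subsets of [T] that
    separates points; its indicator functions embed [T] into a Sigma-product
    ([image_corson]).

    This family is found on [A]. For a set [M] of coordinates closed under a
    suitable countable-valued operation, setting the coordinates outside [M] to
    zero maps [A] into itself and is compatible with the fibres of [f]; this uses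
    that a clopen subset of [A] is determined by countably many coordinates
    ([rel_clopen_determined]) and that the images of two restricted points are
    told apart by nodes decided inside [M]. Along a well-order of the coordinates
    these sets [M] form a continuous increasing chain, and the restrictions of one
    point, having countable support, change at countably many stages only. So the
    sets of points where membership in a set of the family of a stage changes at
    that stage form a point-countable family, and transfinite induction shows that
    it separates the fibres of [f] ([good_step], [restriction_family]). *)

(** * Cardinality *)

Lemma countable_image (T U : Type) (A : set T) (f : T -> U) :
  countable A -> countable (f @` A).
Proof. exact: sub_countable (card_image_le _ _). Qed.

Lemma countable_setU (T : Type) (A B : set T) :
  countable A -> countable B -> countable (A `|` B).
Proof.
move=> Ac Bc; rewrite -bigcup2E; apply: bigcup_countable; first exact: countableP.
by move=> [|[|n]] _ //=; exact: countable0.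
Qed.

(** A maximal set of choice functions whose values differ in every coordinate
    must exhaust some member of [F]: otherwise one more choice function could be
    added. Its projections then inject that member into all the others. *)
Lemma smallest_cardinal (T : Type) (F : set (set T)) :
  F !=set0 -> exists2 K, F K & forall C, F C -> K #<= C.
Proof.
move=> [C0 FC0].
pose I := {C : set T | F C}.
pose matching (M : set (I -> T)) :=
  (forall m, M m -> forall i, sval i (m i)) /\
  (forall m m' i, M m -> M m' -> m i = m' i -> m = m').
have [|M [[MF Minj] Mmax]] := @Zorn_bigcup _ [set M | matching M].
  move=> S Sm Stot; split.
    by move=> m [M SM Mm]; exact: (Sm _ SM).1.
  move=> m m' i [M SM Mm] [M' SM' Mm'].
  have [MM'|M'M] := Stot _ _ SM SM'.
    by apply: (Sm _ SM').2 => //; exact: MM'.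
  by apply: (Sm _ SM).2 => //; exact: M'M.
have [i iM] : exists i : I, forall x, sval i x -> exists2 m, M m & m i = x.
  apply: contrapT => noti.
  have miss i : exists x, sval i x /\ forall m, M m -> m i <> x.
    apply: contrapT => H; apply: noti; exists i => x ix.
    apply: contrapT => H'; apply: H; exists x; split=> // m Mm mx.
    by apply: H'; exists m.
  pose m i := sval (cid (miss i)).
  have mP i : sval i (m i) /\ forall m', M m' -> m' i <> m i := svalP (cid (miss i)).
  have Mm : ~ M m by move=> Mm; exact: (mP (exist _ C0 FC0)).2 Mm erefl.
  apply: (Mmax (M `|` [set m])).
    split; first by move=> ? ?; left.
    by move=> /(_ m (or_intror erefl)).
  split.
    by move=> m' [/MF//|->] i; exact: (mP i).1.
  move=> m1 m2 i [M1|->] [M2|->] //.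
  - exact: Minj.
  - by move=> /((mP i).2 _ M1).
  - by move=> /esym /((mP i).2 _ M2).
exists (sval i); first exact: (svalP i).
move=> C FC; pose j : I := exist _ C FC.
have Ei : sval i = (fun m : I -> T => m i) @` M.
  apply/seteqP; split=> [x /iM [m Mm <-]|_ [m Mm <-]]; last exact: MF.
  by exists m.
have jC : (fun m : I -> T => m j) @` M `<=` C.
  by move=> _ [m Mm <-]; exact: (MF _ Mm j).
have inj_ev k : {in M &, injective (fun m : I -> T => m k)}.
  by move=> m m' /set_mem Mm /set_mem Mm'; exact: Minj.
apply: card_le_trans (subset_card_le jC).
rewrite Ei (card_le_eql (inj_card_eq (inj_ev i))).
by rewrite (card_le_eqr (inj_card_eq (inj_ev j))).
Qed.

(** * Trees and cofinality *)

Section Trees.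
Context {d : Order.disp_t} {T : porderType d}.

Lemma tree_total (treeT : is_tree T) (s s' t : T) :
  s <= t -> s' <= t -> s <= s' \/ s' <= s.
Proof.
move=> st s't; move: (st) (s't).
rewrite le_eqVlt => /predU1P[-> |st']; first by right.
rewrite le_eqVlt => /predU1P[-> |s't']; first by left.
by have /orP := wo_chainW (treeT t) st' s't'.
Qed.

Lemma tree_least (treeT : is_tree T) (t : T) (S : set T) :
  S `<=` [set s | s <= t] -> S !=set0 -> exists2 m, S m & forall s, S s -> m <= s.
Proof.
move=> St [s0 Ss0].
have [[s [Ss st]]|none] := pselect (exists s, S s /\ s < t); last first.
  have eqt s : S s -> s = t.
    move=> Ss; have := St _ Ss; rewrite /= le_eqVlt => /predU1P[//|st].
    by exfalso; apply: none; exists s.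
  by exists s0 => // s Ss; rewrite (eqt _ Ss0) (eqt _ Ss).
have [||m [[/andP[/asboolP Sm mt] mlb] _]] := treeT t [pred s | `[< S s >] && (s < t)].
- by move=> x /andP[].
- by exists s; rewrite inE; apply/andP; split=> //; exact/asboolP.
exists m => // u Su.
have := St _ Su; rewrite /= le_eqVlt => /predU1P[->|ut]; first exact: ltW.
by apply: mlb; rewrite inE; apply/andP; split=> //; apply/asboolP.
Qed.

Lemma finite_chain_bounded (t : T) (l : seq T) :
  (forall s s', s < t -> s' < t -> s <= s' \/ s' <= s) ->
  limit_height t -> (forall s, s \in l -> s < t) ->
  exists2 m, m < t & forall s, s \in l -> s <= m.
Proof.
move=> tot [[s0 s0t] _]; elim: l => [|s l IH] lt; first by exists s0.
have [|m mt ml] := IH; first by move=> x xl; apply: lt; rewrite inE xl orbT.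
have st : s < t by apply: lt; rewrite inE eqxx.
have [sm|ms] := tot _ _ st mt.
  by exists m => // x; rewrite inE => /predU1P[->//|/ml].
by exists s => // x; rewrite inE => /predU1P[->//|/ml /le_trans]; apply.
Qed.

Lemma cofinal_infinite (t : T) (C : set T) :
  (forall s s', s < t -> s' < t -> s <= s' \/ s' <= s) ->
  limit_height t -> cofinal_below t C -> infinite_set C.
Proof.
move=> tot lim [Ct Ccof] /finite_seqP[l Cl].
have [|m mt ml] := @finite_chain_bounded t l tot lim.
  by move=> s sl; apply: Ct; rewrite Cl.
apply: lim.2; exists m => // s /Ccof[c]; rewrite Cl => /ml cm sc.
exact: le_trans sc cm.
Qed.

Lemma cf_finiteP (t : T) :
  (forall s s', s < t -> s' < t -> s <= s' \/ s' <= s) ->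
  cf_finite t <-> ~ limit_height t.
Proof.
move=> tot; split=> [[K [Klim _] Kfin] lim|nlim].
  by have [Kcof _] := Klim lim; exact: (cofinal_infinite tot lim Kcof).
exists set0 => //; split=> //.
Qed.

Hypothesis treeT : is_tree T.

Let below_total (t s s' : T) : s < t -> s' < t -> s <= s' \/ s' <= s.
Proof. by move=> /ltW + /ltW; exact: tree_total. Qed.

Lemma tree_cf_finiteP (t : T) : cf_finite t <-> ~ limit_height t.
Proof. by apply: cf_finiteP; exact: below_total. Qed.

Lemma cf_omegaP (t : T) :
  cf_omega t <-> limit_height t /\ exists2 C, cofinal_below t C & countable C.
Proof.
split=> [[K [Klim Knlim] Kn]|[lim [C Ccof Cc]]].
  have [lim|nlim] := pselect (limit_height t).
    split=> //; exists K; first exact: (Klim lim).1.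
    by rewrite (eq_countable Kn); exact: countableP.
  have K0 := Knlim nlim; exfalso; move: Kn; rewrite K0.
  by move=> /eq_finite_set e; apply: infinite_nat; rewrite -e.
have Cinf := cofinal_infinite (@below_total t) lim Ccof.
exists C; last exact: eq_card_nat.
split=> // _; split=> // C' C'cof.
apply: (card_le_trans Cc).
by apply/infiniteP; exact: (cofinal_infinite (@below_total t) lim C'cof).
Qed.

Lemma cf_uncountableP (t : T) : cf_uncountable t <-> limit_height t /\ ~ cf_omega t.
Proof.
split=> [[K [Klim Knlim] Kunc]|[lim nom]].
  have lim : limit_height t.
    by apply: contrapT => /Knlim K0; apply: Kunc; rewrite K0.
  split=> // /cf_omegaP[_ [C Ccof Cc]]; apply: Kunc.
  by apply: (card_le_trans _ Cc); exact: (Klim lim).2.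
have [|K Kcof Kmin] := @smallest_cardinal T (cofinal_below t).
  by exists (predecessors t); split=> // s st; exists s.
exists K; first by split.
by move=> Kc; apply: nom; apply/cf_omegaP; split=> //; exists K.
Qed.

(** The form in which uncountable cofinality is used: a sequence below such a
    limit stays strictly below some earlier node. *)
Lemma sequence_bounded (t : T) (s : nat -> T) : limit_height t -> ~ cf_omega t ->
  (forall n, s n < t) -> exists2 u, u < t & forall n, s n < u.
Proof.
move=> lim nom st; apply: contrapT => H; apply: nom.
apply/cf_omegaP; split=> //; exists (range s); last first.
  by apply: countable_image; exact: countableP.
split=> [_ [n _ <-]|u ut]; first exact: st.
apply: contrapT => H'.
apply: H; exists u => // n; rewrite lt_neqAle; apply/andP; split.
  by apply/eqP => e; apply: H'; exists (s n); [exists n|rewrite e].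
have [//|us] := below_total (st n) ut.
by exfalso; apply: H'; exists (s n) => //; exists n.
Qed.

Lemma successor_below (s t : T) : s < t ->
  exists k, [/\ s < k, k <= t, ~ limit_height k & forall q, s < q -> q <= t -> k <= q].
Proof.
move=> st.
have [||k [sk kt] kmin] := @tree_least treeT t [set q | s < q /\ q <= t].
- by move=> q [].
- by exists t.
exists k; split=> //; last by move=> q sq qt; exact: kmin.
move=> [_]; apply; exists s => // q /= qk.
have [|//] := tree_total treeT (ltW st) (le_trans (ltW qk) kt).
rewrite le_eqVlt => /predU1P[->//|sq].
have := kmin q (conj sq (le_trans (ltW qk) kt)).
by move=> kq; have := le_lt_trans kq qk; rewrite ltxx.
Qed.

Lemma successor_below_limit (s t : T) : limit_height t -> s < t ->
  exists k, [/\ s < k, k < t & ~ limit_height k].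
Proof.
move=> lim st; have [k [sk kt nl _]] := successor_below st.
by exists k; split=> //; rewrite lt_neqAle kt andbT; apply/eqP => e; rewrite e in nl.
Qed.

Hypothesis completeT : chain_complete T.

(** The predecessors of a limit node [t] have a supremum; it cannot lie strictly
    below [t], so it is [t]. Hence limit nodes are determined by what precedes
    them. *)
Lemma limit_le (t u : T) : limit_height t -> (forall s, s < t -> s <= u) -> t <= u.
Proof.
move=> lim ub.
have [|m [mub mleast]] := completeT (A := predecessors t).
  by move=> x y; exact: below_total.
have mt : m <= t by apply: mleast => x /ltW.
suff -> : t = m by exact: mleast.
move: mt; rewrite le_eqVlt => /predU1P[//|mt].
by exfalso; apply: lim.2; exists m.
Qed.

(** Two nodes are separated by the first node at which the branch to [t] leaves
    the branch to [u]. By [limit_le] that node is never a limit, so its wedge is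
    clopen in both topologies. *)
Lemma first_outside (t u : T) : ~ t <= u ->
  exists k, [/\ k <= t, ~ k <= u, ~ limit_height k &
    forall s, s <= t -> ~ s <= u -> k <= s].
Proof.
move=> tu.
have [||k [kt ku] kmin] := @tree_least treeT t [set q | q <= t /\ ~ q <= u].
- by move=> q [].
- by exists t.
exists k; split=> //; last by move=> s st su; exact: kmin.
move=> lim; apply: ku; apply: limit_le => // s sk; apply: contrapT => su.
have := kmin s (conj (le_trans (ltW sk) kt) su).
by move=> /(lt_le_trans sk); rewrite ltxx.
Qed.

Lemma eq_nodes (t u : T) :
  (forall q, ~ limit_height q -> q <= t <-> q <= u) -> t = u.
Proof.
move=> H; apply/le_anti/andP; split; apply: contrapT => /first_outside[k [k1 k2 nl _]].
  by apply: k2; apply/(H _ nl).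
by apply: k2; apply/(H _ nl).
Qed.

Lemma tree_meet (u v : T) :
  exists w, [/\ w <= u, w <= v & forall s, s <= u -> s <= v -> s <= w].
Proof.
have [|w [wub wleast]] := completeT (A := [set s | s <= u /\ s <= v]).
  by move=> x y [xu _] [yu _]; exact: tree_total xu yu.
exists w; split.
- by apply: wleast => x [].
- by apply: wleast => x [].
- by move=> s su sv; exact: wub.
Qed.

Hypothesis rootedT : rooted T.

Lemma tree_root : exists r : T, forall t, r <= t.
Proof.
have [r [rmin runiq]] := rootedT; exists r => t.
have [||m mt mmin] := @tree_least treeT t [set q | q <= t].
- by [].
- by exists t => /=.
suff -> : r = m by [].
by apply: runiq => x xm; apply: mmin; exact: le_trans xm mt.
Qed.

Lemma root_not_limit (r : T) : (forall t, r <= t) -> ~ limit_height r.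
Proof. by move=> rle [[s /(le_lt_trans (rle s))]]; rewrite ltxx. Qed.

Lemma cf_omega_limit (t : T) : cf_omega t -> limit_height t.
Proof. by move=> /cf_omegaP[]. Qed.

(** Whatever the cofinality of [p], a single sequence of nodes of cofinality other
    than omega dominates all such nodes below [p]: it is constant, or it climbs to
    [p] along successors. This makes the topologies Frechet at the points of [T]. *)
Lemma node_sequence (p : T) : exists r : nat -> T,
  (forall n, ~ cf_omega (r n) /\ r n <= p) /\
  forall q, ~ cf_omega q -> q <= p -> exists n, forall m, (n <= m)%N -> q <= r m.
Proof.
have [/cf_omegaP[lim [C [Cp Ccof] Cc]]|nom] := pselect (cf_omega p); last first.
  by exists (fun=> p); split=> // q _ qp; exists 0%N.
have [[c0 c0p] _] := lim; have [c Cc0 _] := Ccof _ c0p.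
have /pfcard_geP[C0|[e]] := Cc; first by move: Cc0; rewrite C0.
have ep n : e n < p by apply: Cp; exact: funS.
have /choice[sc scP] n : exists k, [/\ e n < k, k < p & ~ limit_height k].
  exact: successor_below_limit.
pose fix r n := if n is m.+1 then (if r m <= sc m.+1 then sc m.+1 else r m) else sc 0%N.
have rP n : [/\ r n < p & ~ cf_omega (r n)].
  elim: n => [|n [IH1 IH2]] /=.
    by have [? ? nl] := scP 0%N; split=> // /cf_omega_limit.
  case: ifP => _; last by [].
  by have [? ? nl] := scP n.+1; split=> // /cf_omega_limit.
have rmono n m : (n <= m)%N -> r n <= r m.
  move=> /subnK <-; elim: (m - n)%N => [//|i IH]; rewrite addSn /=.
  by case: ifP => // /(le_trans IH).
have scr n : sc n <= r n.
  case: n => [//|n] /=; case: ifP => // h.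
  have [_ s1 _] := scP n.+1; have [r1 _] := rP n.
  by have [|//] := below_total r1 s1; rewrite h.
exists r; split=> [n|q nomq qp].
  by have [/ltW ? ?] := rP n.
have {}qp : q < p.
  rewrite lt_neqAle qp andbT; apply/eqP => e1; apply: nomq; rewrite e1.
  by apply/cf_omegaP; split=> //; exists C.
have [c' /(@surj _ _ _ _ e)[n _ <-] qc] := Ccof _ qp.
exists n => m nm; apply: (le_trans qc); apply: (le_trans _ (rmono _ _ nm)).
apply: (le_trans _ (scr n)); have [/ltW] := scP n; by [].
Qed.

End Trees.
(** * Closing off under a countable-valued operation *)

Section Hull.
Context {G : eqType} (h : seq G -> set G).
Implicit Types (B M : set G) (s : seq G).

Definition lists B : set (seq G) := [set s | forall g, g \in s -> B g].

Definition hull_closed M := forall s, lists M s -> h s `<=` M.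

Definition hull B : set G :=
  [set g | forall M, hull_closed M -> B `<=` M -> M g].

Lemma hull_closed_hull B : hull_closed (hull B).
Proof.
move=> s sB g hg M Mcl BM; apply: (Mcl s) => // g' g's; exact: sB.
Qed.

Lemma sub_hull B : B `<=` hull B.
Proof. by move=> g Bg M _; exact. Qed.

Lemma hull_min B M : hull_closed M -> B `<=` M -> hull B `<=` M.
Proof. by move=> Mcl BM g; exact. Qed.

Lemma hull_mono B B' : B `<=` B' -> hull B `<=` hull B'.
Proof.
move=> BB'; apply: hull_min; first exact: hull_closed_hull.
exact: subset_trans BB' (@sub_hull _).
Qed.

Lemma chain_union_closed (F : set (set G)) : F !=set0 ->
  total_on F subset -> (forall M, F M -> hull_closed M) ->
  hull_closed (\bigcup_(M in F) M).
Proof.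
move=> [M0 FM0] Ftot Fcl s sU.
suff [M FM sM] : exists2 M, F M & lists M s.
  by move=> g hg; exists M => //; exact: (Fcl _ FM s).
elim: s sU => [_|g s IH sU]; first by exists M0.
have [|M FM sM] := IH; first by move=> x xs; apply: sU; rewrite inE xs orbT.
have [M' FM' M'g] : (\bigcup_(M in F) M) g by apply: sU; rewrite inE eqxx.
have [MM'|M'M] := Ftot _ _ FM FM'.
  exists M' => // x; rewrite inE => /predU1P[->//|/sM]; exact: MM'.
exists M => // x; rewrite inE => /predU1P[->|/sM//]; exact: M'M.
Qed.

Lemma countable_lists B : countable B -> countable (lists B).
Proof.
move=> /countable_injP[f finj]; apply/countable_injP.
exists (fun s => pickle (map f s)) => s s' /set_mem sB /set_mem s'B.
move=> /(pcan_inj pickleK); elim: s s' sB s'B => [|g s IH] [|g' s'] //= sB s'B [e es].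
congr cons.
  by apply: finj => //; apply/mem_set; [apply: sB|apply: s'B]; rewrite inE eqxx.
by apply: IH es => x xs; [apply: sB|apply: s'B]; rewrite inE xs orbT.
Qed.

Lemma countable_hull B :
  (forall s, countable (h s)) -> countable B -> countable (hull B).
Proof.
move=> hc Bc.
pose step C := C `|` \bigcup_(s in lists C) h s.
pose C := fix C n := if n is m.+1 then step (C m) else B.
have Cc n : countable (C n).
  elim: n => [//|n IH] /=; apply: countable_setU => //.
  apply: bigcup_countable; first exact: countable_lists.
  by move=> s _; exact: hc.
have Cmono n m : (n <= m)%N -> C n `<=` C m.
  move=> /subnK <-; elim: (m - n)%N => [//|i IH]; rewrite addSn /=.
  by move=> x /IH Cx; left.
have cl : hull_closed (\bigcup_n C n).
  move=> s sC; have [n sn] : exists n, lists (C n) s.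
    elim: s sC => [|g s IH] sC; first by exists 0%N.
    have [|n sn] := IH; first by move=> x xs; apply: sC; rewrite inE xs orbT.
    have [m _ gm] := sC g (mem_head _ _).
    exists (maxn n m) => x; rewrite inE => /predU1P[->|/sn xn].
      exact: Cmono (leq_maxr _ _) _ gm.
    exact: Cmono (leq_maxl _ _) _ xn.
  by move=> g hg; exists n.+1 => //=; right; exists s.
apply: (@sub_countable _ _ _ (\bigcup_n C n)).
  by apply: subset_card_le; apply: hull_min => // g Bg; exists 0%N.
by apply: bigcup_countable => //; exact: countableP.
Qed.

(** Finite pieces of [B] that eventually contain each given element; this also
    covers the empty set, where no enumeration exists. *)
Lemma countable_exhaustion B : countable B -> exists s : nat -> seq G,
  (forall n, lists B (s n)) /\
  forall g, B g -> exists n, forall m, (n <= m)%N -> g \in s m.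
Proof.
move=> /pfcard_geP[->|[e]]; first by exists (fun=> [::]); split.
exists (fun n => map e (iota 0 n)); split=> [n g /mapP[i _ ->]|g Bg].
  exact: funS.
have [n _ <-] := @surj _ _ _ _ e _ Bg; exists n.+1 => m nm.
by apply/mapP; exists n => //; rewrite mem_iota.
Qed.

End Hull.

(** * Countable compactness through subsequential limits *)

Section CountablyCompact.
Context {X : topologicalType}.
Implicit Types (A : set X) (e : nat -> X).

(** A cluster point of the sequence, recorded with a filter on the indices along
    which the sequence converges: such limits pass through continuous maps and
    combine with eventual properties as ordinary limits do. *)
Definition sublimit e (x : X) := exists F : set_system nat,
  [/\ ProperFilter F, forall n, F [set m | (n <= m)%N] & e @ F --> x].

Lemma sublimitP e (x : X) :
  (forall n P, nbhs x P -> exists2 m, (n <= m)%N & P (e m)) -> sublimit e x.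
Proof.
move=> clx.
pose F := filter_from [set P : set X * nat | nbhs x P.1]
            (fun P => [set m | (P.2 <= m)%N /\ P.1 (e m)]).
exists F; split.
- apply: filter_from_proper; first apply: filter_from_filter.
  + by exists (setT, 0%N); exact: filterT.
  + move=> [P n] [Q m] /= xP xQ; exists (P `&` Q, maxn n m); first exact: filterI.
    by move=> i /= []; rewrite geq_max => /andP[ni mi] [Pi Qi].
  + by move=> [P n] /= xP; have [m nm Pm] := clx n _ xP; exists m.
- by move=> n; exists (setT, n) => /= [|m []//]; exact: filterT.
- by move=> P xP; exists (P, 0%N) => // m [].
Qed.

Lemma countably_compact_sublimit A e : countably_compact A ->
  (forall n, A (e n)) -> exists2 x, A x & sublimit e x.
Proof.
move=> Acc Ae; apply: contrapT => H.
pose U n := ~` closure (e @` [set m | (n <= m)%N]).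
have Uopen n : open (U n) by apply: closed_openC; exact: closed_closure.
have [] := Acc setT U.
- by move=> n _; exact: Uopen.
- move=> x Ax; apply: contrapT => nU; apply: H; exists x => //.
  apply: sublimitP => n P xP.
  have clx : closure (e @` [set m | (n <= m)%N]) x.
    by apply: contrapT => nc; apply: nU; exists n.
  by have [_ [[m nm <-] Pm]] := clx _ xP; exists m.
move=> D _ AD; pose N := \max_(i <- finmap.enum_fset D) i.
have [i iD] := AD _ (Ae N); apply; apply: subset_closure; exists N => //=.
by apply: leq_bigmax_seq.
Qed.

Lemma compact_sublimit A e : compact A ->
  (forall n, A (e n)) -> exists2 x, A x & sublimit e x.
Proof.
move=> Ac Ae; have [|x [Ax clx]] := Ac (e @ \oo) _.
  by apply: (@filterE _ \oo).
exists x => //; apply: sublimitP => n P xP.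
have [_ [[m nm <-] Pm]] : (e @` [set m | (n <= m)%N]) `&` P !=set0.
  by apply: clx => //; exists n => // m nm; exists m.
by exists m.
Qed.

Lemma sublimit_countably_compact A :
  (forall e, (forall n, A (e n)) -> exists2 x, A x & sublimit e x) ->
  countably_compact A.
Proof.
move=> H D U Uo AU; apply: contrapT => nfin.
have /choice[e eP] n : exists x, A x /\ forall i, (i <= n)%N -> D i -> ~ U i x.
  apply: contrapT => nx; apply: nfin.
  have fin : finite_set (`I_n.+1 `&` D) by exact/finite_setIl/finite_II.
  exists (fset_set (`I_n.+1 `&` D)).
    by move=> i; rewrite in_fset_set // => /set_mem[_ Di]; exact/mem_set.
  move=> x Ax; apply: contrapT => nxU; apply: nx; exists x; split=> // i ni Di Ux.
  by apply: nxU; exists i => //=; rewrite in_fset_set //; apply/mem_set.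
have [|x Ax [F [FF Fn ex]]] := H e; first by move=> n; have [] := eP n.
have [i Di Ux] := AU _ Ax.
have [n [/= ni Un]] : exists n, (i <= n)%N /\ U i (e n).
  apply: (@filter_ex _ F); apply: filterI; first exact: Fn.
  by apply: ex; apply: open_nbhs_nbhs; split=> //; exact: Uo.
by have [_ /(_ _ ni Di)] := eP n.
Qed.

End CountablyCompact.

Lemma set_type_nbhsP (X : topologicalType) (A : set X) (a : set_type A) B :
  nbhs a B <-> exists2 W, nbhs (set_val a) W & forall b : set_type A, W (set_val b) -> B b.
Proof.
split=> [|[W]].
  rewrite nbhsE => -[U [[W Wo <-] Ua] UB]; exists W; first by exists W.
  by move=> b Wb; exact: UB.
rewrite nbhsE => -[V [Vo Va] VW] WB; rewrite nbhsE; exists (set_val @^-1` V).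
  by split=> //; exists V.
by move=> b Vb; apply: WB; exact: VW.
Qed.

(** * Subsets of Sigma-products *)

Section Cube.
Context {R : realType} {G : choiceType}.
Local Notation E := {ptws G -> R}.
Implicit Types (x y : E) (M N : set G) (A S P Q : set E).
Local Open Scope ring_scope.

#[global] Instance ptws_nbhs_filter x : ProperFilter (nbhs x) | 0 := nbhs_pfilter x.

Let ptws_cvg_filter (F : set_system E) x : Filter F ->
  (forall g, (fun y : E => y g) @ F --> x g) -> F --> x.
Proof.
move=> FF H; apply/cvg_sup => g A; rewrite nbhsE => -[_ [[B Bo <-] Bx] BA].
rewrite /nbhs /=; apply: filterS BA _.
by apply: (H g B); exact: open_nbhs_nbhs.
Qed.

Lemma ptws_cvg {I : Type} (F : set_system I) (e : I -> E) x : Filter F ->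
  (forall g, (fun i => e i g) @ F --> x g) -> e @ F --> x.
Proof. by move=> FF H; apply: ptws_cvg_filter. Qed.

Lemma ptws_eval g : continuous (fun x : E => x g).
Proof. exact: (@proj_continuous G (fun=> R)). Qed.

Lemma ptws_hausdorff : hausdorff_space E.
Proof. by apply: hausdorff_product => _; exact: Rhausdorff. Qed.

Definition supp x : set G := [set g | x g != 0].

Definition restr M x : E := fun g => if g \in M then x g else 0.

Lemma restr_in M x g : M g -> restr M x g = x g.
Proof. by move=> Mg; rewrite /restr mem_set. Qed.

Lemma restr_out M x g : ~ M g -> restr M x g = 0.
Proof. by move=> Mg; rewrite /restr memNset. Qed.

Lemma restr_id M x : supp x `<=` M -> restr M x = x.
Proof.
move=> xM; apply/funext => g; have [Mg|Mg] := pselect (M g); first exact: restr_in.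
rewrite restr_out //; apply: contrapT => xg; apply: Mg; apply: xM.
by apply/eqP => /esym.
Qed.

Lemma restr_continuous M : continuous (restr M).
Proof.
move=> x; apply: ptws_cvg => g.
have [Mg|Mg] := pselect (M g).
  have -> : (fun y : E => restr M y g) = (fun y => y g).
    by apply/funext => y; exact: restr_in.
  by rewrite (restr_in x Mg); exact: ptws_eval.
have -> : (fun y : E => restr M y g) = cst 0.
  by apply/funext => y; exact: restr_out.
by rewrite (restr_out x Mg); exact: cvg_cst.
Qed.

Lemma exhaustion_cvg (s : nat -> seq G) M x (e : nat -> E) :
  (forall g, M g -> exists n, forall m, (n <= m)%N -> g \in s m) ->
  (forall n g, g \in s n -> `|e n g - x g| < n.+1%:R^-1) ->
  (forall n, supp (e n) `<=` M) ->
  e @ \oo --> restr M x.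
Proof.
move=> sM ex eM; apply: ptws_cvg => g; have [Mg|Mg] := pselect (M g).
  rewrite restr_in //; apply/cvgrPdist_lt => /= eps eps0.
  have [n0 n0P] := sM _ Mg; near=> n; rewrite distrC.
  apply: (lt_trans (ex n g _)).
    by apply: n0P; near: n; exact: nbhs_infty_ge.
  by near: n; exact: (near_infty_natSinv_lt (PosNum eps0)).
rewrite restr_out //; apply: (cvg_trans _ (@cvg_cst _ (0:R) _ \oo _)).
apply: near_eq_cvg; apply: nearW => n /=; apply: contrapT => eg; apply: Mg.
by apply: (eM n); apply/eqP => /esym.
Unshelve. all: by end_near. Qed.

Lemma closure_approx P x (s : seq G) n : closure P x ->
  exists2 y, P y & forall g, g \in s -> `|y g - x g| < n.+1%:R^-1.
Proof.
move=> clP.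
have [|y [Py ys]] := clP [set y | forall g, g \in s -> `|y g - x g| < n.+1%:R^-1].
  elim: s => [|g s IH]; first by apply: (@filterE _ (nbhs x)) => y g.
  have near_g : \forall y \near x, `|y g - x g| < n.+1%:R^-1.
    have : (fun y : E => y g) @ x --> x g by exact: ptws_eval.
    move=> /cvgrPdist_lt/(_ n.+1%:R^-1).
    rewrite invr_gt0 ltr0n => /(_ isT); apply: filterS => y.
    by rewrite distrC.
  apply: (@filterS2 _ (nbhs x) _ _ _ _ _ near_g IH) => y yg ys g'.
  by rewrite inE => /predU1P[->//|]; exact: ys.
by exists y.
Qed.

(** Points of [P] and [Q] approximating [x] on ever larger finite sets of
    coordinates are chosen inside a countable set [M] closed under taking the
    supports of the chosen points. Outside [M] all of them vanish, so both
    sequences converge to the restriction of [x] to [M]. *)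
Lemma closure_restr_seq P Q x :
  (forall y, P y -> countable (supp y)) -> (forall y, Q y -> countable (supp y)) ->
  closure P x -> closure Q x ->
  exists M (e f : nat -> E), [/\ forall n, P (e n), forall n, Q (f n),
    forall n, supp (e n) `<=` M, forall n, supp (f n) `<=` M &
    e @ \oo --> restr M x /\ f @ \oo --> restr M x].
Proof.
move=> Pc Qc clP clQ.
have /choice[e0 e0P] (sn : seq G * nat) : exists y, P y /\
    forall g, g \in sn.1 -> `|y g - x g| < sn.2.+1%:R^-1.
  by have [y Py ys] := closure_approx sn.1 sn.2 clP; exists y.
have /choice[f0 f0P] (sn : seq G * nat) : exists y, Q y /\
    forall g, g \in sn.1 -> `|y g - x g| < sn.2.+1%:R^-1.
  by have [y Qy ys] := closure_approx sn.1 sn.2 clQ; exists y.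
pose h (s : seq G) := \bigcup_n (supp (e0 (s, n)) `|` supp (f0 (s, n))).
have hc s : countable (h s).
  apply: bigcup_countable => [|n _]; first exact: countableP.
  by apply: countable_setU; [exact/Pc/(e0P _).1 | exact/Qc/(f0P _).1].
have [s [sM sex]] := countable_exhaustion (countable_hull hc (@countable0 G)).
exists (hull h set0), (fun n => e0 (s n, n)), (fun n => f0 (s n, n)).
have eM n : supp (e0 (s n, n)) `<=` hull h set0.
  by move=> g eg; apply: (hull_closed_hull (sM n)); exists n => //; left.
have fM n : supp (f0 (s n, n)) `<=` hull h set0.
  by move=> g eg; apply: (hull_closed_hull (sM n)); exists n => //; right.
split => //; [by move=> n; exact: (e0P _).1|by move=> n; exact: (f0P _).1|].
split; apply: (exhaustion_cvg sex) => // n g gs.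
  exact: (e0P (s n, n)).2.
exact: (f0P (s n, n)).2.
Qed.

(** Applying [closure_restr_seq] to [P] and to the singleton of [x] forces the
    support of [x] into [M], so that the restriction of [x] is [x]. *)
Lemma sigma_frechet P x : (forall y, P y -> countable (supp y)) ->
  countable (supp x) -> closure P x ->
  exists2 e : nat -> E, (forall n, P (e n)) & e @ \oo --> x.
Proof.
move=> Pc xc clP.
have [|||M [e [f [eP fx eM fM [ex' fx']]]]] := @closure_restr_seq P [set x] x Pc.
- by move=> y ->.
- exact: clP.
- exact: subset_closure.
exists e => //; suff <- : restr M x = x by [].
by apply: restr_id; rewrite -(fx 0%N); exact: fM.
Qed.

Lemma sublimit_supp (e : nat -> E) x : sublimit e x ->
  supp x `<=` \bigcup_n supp (e n).
Proof.
move=> [F [FF _ ex]] g xg; apply: contrapT => ng.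
have eg : (fun n => e n g) @ F --> x g by apply: cvg_comp ex (@ptws_eval g x).
have e0 : (fun n => e n g) = cst 0.
  apply/funext => n; apply: contrapT => eg0; apply: ng; exists n => //.
  by apply/eqP.
rewrite e0 in eg; move: xg; rewrite /supp /= => /eqP; apply.
exact: (@cvg_unique _ (@Rhausdorff R) ((cst 0 : nat -> R) @ F) _ _ _ eg (cvg_cst _)).
Qed.

(** Membership in [S] is locally constant along [A]; [S] itself may stick out of
    [A], which keeps preimages under restriction maps simple. *)
Definition rel_clopen A S := forall x, A x ->
  \forall y \near x, A y -> (S y <-> S x).

Lemma rel_clopenC A S : rel_clopen A S -> rel_clopen A (~` S).
Proof.
move=> SA x Ax; apply: filterS (SA x Ax) => y H Ay; split => nS Sy; apply: nS.
  exact/(H Ay).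
exact/(H Ay).
Qed.

Lemma rel_clopenI A S S' : rel_clopen A S -> rel_clopen A S' -> rel_clopen A (S `&` S').
Proof.
move=> SA SA' x Ax; apply: filterS2 (SA x Ax) (SA' x Ax) => y H H' Ay.
by split=> -[/(H Ay) ? /(H' Ay) ?].
Qed.

Section CountablyCompactSigma.
Variables (A : set E).
Hypotheses (A_sigma : forall x, A x -> countable (supp x)).
Hypothesis (A_cc : countably_compact A).

Lemma seq_closed (e : nat -> E) x : (forall n, A (e n)) -> e @ \oo --> x -> A x.
Proof.
move=> Ae ex; have [x' Ax' [F [FF Fn ex']]] := countably_compact_sublimit A_cc Ae.
suff -> : x = x' by [].
apply: (@cvg_unique _ ptws_hausdorff (e @ F)) => //.
apply: cvg_trans ex; apply: cvg_app => B [n _ nB].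
by apply: filterS (Fn n) => m /nB.
Qed.

(** A common point [x] of the closures would give, by [closure_restr_seq], one
    point of [A] (a restriction of [x]) that is a limit from both pieces. *)
Lemma rel_clopen_disjoint_closure S x : rel_clopen A S ->
  closure (A `&` S) x -> ~ closure (A `&` ~` S) x.
Proof.
move=> SA cl1 cl2.
have [||||M [e [f [eA fA _ _ [ex fx]]]]] := @closure_restr_seq (A `&` S) (A `&` ~` S) x.
- by move=> y [/A_sigma].
- by move=> y [/A_sigma].
- exact: cl1.
- exact: cl2.
have Ax : A (restr M x) by apply: (seq_closed _ ex) => n; exact: (eA n).1.
pose U y := A y -> (S y <-> S (restr M x)); have nU : nbhs (restr M x) U := SA _ Ax.
have [n [/= U1 U2]] : exists n, U (e n) /\ U (f n).
  by apply: (@filter_ex _ \oo); apply: filterI; [exact: ex|exact: fx].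
apply: (fA n).2; apply/(U2 (fA n).1)/(U1 (eA n).1); exact: (eA n).2.
Qed.

(** Otherwise there are points [e n] in [S] and [f n] outside [S] agreeing on
    the supports of all earlier pairs. A cluster point of the [e n] is then also a
    cluster point of the [f n]. *)
Lemma rel_clopen_determined S : rel_clopen A S ->
  exists2 N, countable N &
    forall x y, A x -> A y -> (forall g, N g -> x g = y g) -> (S x <-> S y).
Proof.
move=> SA; apply: contrapT => H.
have bad N : countable N -> exists xy : E * E, [/\ A xy.1, A xy.2,
    (forall g, N g -> xy.1 g = xy.2 g), S xy.1 & ~ S xy.2].
  move=> Nc; apply: contrapT => H'; apply: H; exists N => // x y Ax Ay xy.
  apply: contrapT => nSxy; apply: H'.
  have [Sx|nSx] := pselect (S x).
    by exists (x, y); split=> // Sy; apply: nSxy.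
  have [Sy|nSy] := pselect (S y).
    by exists (y, x); split=> //= g Ng; rewrite xy.
  by exfalso; apply: nSxy; split.
have /choice[c cP] N : exists xy : E * E, countable N -> [/\ A xy.1, A xy.2,
    (forall g, N g -> xy.1 g = xy.2 g), S xy.1 & ~ S xy.2].
  have [Nc|Nc] := pselect (countable N); last by exists (cst 0, cst 0).
  by have [xy xyP] := bad _ Nc; exists xy.
pose N := fix N n := if n is m.+1
  then N m `|` (supp (c (N m)).1 `|` supp (c (N m)).2) else set0.
have Nc n : countable (N n).
  elim: n => [|n IH]; first exact: countable0.
  have [/A_sigma c1 /A_sigma c2 _ _ _] := cP _ IH.
  by apply: countable_setU => //; exact: countable_setU.
have Nmono n m : (n <= m)%N -> N n `<=` N m.
  move=> /subnK <-; elim: (m - n)%N => [//|i IH]; rewrite addSn /=.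
  by move=> x /IH Cx; left.
pose e n := (c (N n)).1; pose f n := (c (N n)).2.
have [|x Ax [F [FF Fn ex]]] := @countably_compact_sublimit _ A e A_cc.
  by move=> n; have [] := cP _ (Nc n).
have fx : f @ F --> x.
  apply: ptws_cvg => g.
  have eg : (fun n => e n g) @ F --> x g by apply: cvg_comp ex (@ptws_eval g x).
  apply: cvg_trans eg; apply: near_eq_cvg.
  have [[n Ng]|none] := pselect (exists n, N n g).
    apply: filterS (Fn n) => m /= nm; have [_ _ efm _ _] := cP _ (Nc m).
    by apply: efm; exact: (Nmono n).
  (* a coordinate outside every N n vanishes at all e n and f n *)
  apply: nearW => m; apply: contrapT => ne; apply: none; exists m.+1 => /=; right.
  have [e0|e0] := eqVneq (e m g) 0; last by left.
  by right; rewrite /supp /=; apply/eqP => f0; apply: ne; rewrite e0.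
pose U y := A y -> (S y <-> S x); have nU : nbhs x U := SA _ Ax.
have [n [/= U1 U2]] : exists n, U (e n) /\ U (f n).
  by apply: (@filter_ex _ F); apply: filterI; [exact: ex|exact: fx].
have [Ae Af _ Se nSf] := cP _ (Nc n).
by apply: nSf; apply/(U2 Af)/(U1 Ae).
Qed.

End CountablyCompactSigma.
End Cube.

(** * The wedge topologies *)

Section TreeTopology.
Context {d : Order.disp_t} {T : porderType d}.
Implicit Types (p q t : T).

Lemma subbase_cvg (X : topologicalType) (D : set (set X)) (F : set_system X) (p : X) :
  (forall O, open O -> exists2 D', D' `<=` finI_from D id & \bigcup_(A in D') A = O) ->
  Filter F -> (forall A, D A -> A p -> F A) -> F --> p.
Proof.
move=> openE FF FD A; rewrite nbhsE => -[U [Uo Up] UA].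
have [D' D'D D'U] := openE _ Uo.
have [B D'B Bp] : (\bigcup_(A in D') A) p by rewrite D'U.
rewrite /nbhs /=; apply: (@filterS _ _ _ B).
  by move=> x Bx; apply: UA; rewrite -D'U; exists B.
have [K KD KB] := D'D _ D'B; rewrite -KB; apply: filter_bigI => C CK.
by apply: FD; [exact/set_mem/KD | rewrite -KB in Bp; exact: Bp].
Qed.

Lemma wedge_cvg (F : set_system T) p : Filter F ->
  (forall q, cf_finite q -> q <= p -> F (wedge q)) ->
  (forall q, cf_finite q -> ~ q <= p -> F (~` wedge q)) ->
  F --> (p : coarse_wedge T).
Proof.
move=> FF Fin Fout; apply: (@subbase_cvg (coarse_wedge T)
  (wedge_subbase [set t : T | cf_finite t])) => //.
by move=> A [q qf [->|->]] pA; [exact: Fin|exact: Fout].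
Qed.

Lemma sigma_wedge_cvg (F : set_system T) p : Filter F ->
  (forall q, ~ cf_omega q -> q <= p -> F (wedge q)) ->
  (forall q, ~ cf_omega q -> ~ q <= p -> F (~` wedge q)) ->
  F --> (p : sigma_coarse_wedge T).
Proof.
move=> FF Fin Fout; apply: (@subbase_cvg (sigma_coarse_wedge T)
  (wedge_subbase [set t : T | ~ cf_omega t])) => //.
by move=> A [q qf [->|->]] pA; [exact: Fin|exact: Fout].
Qed.

Lemma subbase_mem_open (U : set T) (D : set (set T)) : D U ->
  exists2 D', D' `<=` finI_from D id & \bigcup_(A in D') A = U.
Proof.
move=> DU; exists [set U]; last by rewrite bigcup_set1.
by move=> _ ->; exact: finI_from1.
Qed.

Lemma wedge_open q : cf_finite q -> open (wedge q : set (coarse_wedge T)).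
Proof. by move=> qf; apply: subbase_mem_open; exists q => //; left. Qed.

Lemma wedgeC_open q : cf_finite q -> open (~` wedge q : set (coarse_wedge T)).
Proof. by move=> qf; apply: subbase_mem_open; exists q => //; right. Qed.

Lemma sigma_wedge_open q :
  ~ cf_omega q -> open (wedge q : set (sigma_coarse_wedge T)).
Proof. by move=> qf; apply: subbase_mem_open; exists q => //; left. Qed.

Lemma sigma_wedgeC_open q :
  ~ cf_omega q -> open (~` wedge q : set (sigma_coarse_wedge T)).
Proof. by move=> qf; apply: subbase_mem_open; exists q => //; right. Qed.

Section Nodes.
Hypothesis treeT : is_tree T.

Section Frechet.
Context {X : eqType} (below : T -> X -> Prop) (P : set T).
Hypothesis below_le : forall q q' x, q <= q' -> below q' x -> below q x.
Hypothesis below_total : forall q q' x, below q x -> below q' x -> q <= q' \/ q' <= q.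

(** Choose the [n]-th point above [r n] and off the first nodes at which the
    earlier points leave the branch of [p]. A node not below [p] then lies below
    at most one chosen point, since that first node is under it. Stated for points
    given by their chains of nodes, so that it covers both [T] and [hat T]. *)
Lemma trace_frechet (p : X) (r : nat -> T) (E : set X) :
  (forall n, below (r n) p) ->
  (forall q, P q -> below q p -> exists n, forall m, (n <= m)%N -> q <= r m) ->
  (forall n (l : seq T), (forall q, q \in l -> P q /\ ~ below q p) ->
    exists2 x, E x & below (r n) x /\ forall q, q \in l -> ~ below q x) ->
  exists2 e : nat -> X, (forall n, E (e n)) &
    forall q, P q -> (below q p -> exists n, forall m, (n <= m)%N -> below q (e m)) /\
      (~ below q p -> exists n, forall m, (n <= m)%N -> ~ below q (e m)).
Proof.
move=> rp rcof HE.
pose leaves x q := P q /\ below q x /\ ~ below q p.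
have /choice[k kP] x : exists k, (exists q, leaves x q) ->
    leaves x k /\ forall q, leaves x q -> k <= q.
  have [[q0 q0x]|none] := pselect (exists q, leaves x q); last first.
    by exists (r 0%N) => /none.
  have [||k [kx kq0] kmin] := @tree_least _ _ treeT q0 [set q | leaves x q /\ q <= q0].
  - by move=> q [].
  - by exists q0.
  exists k => _; split=> // q qx.
  have [qq0|q0q] := below_total qx.2.1 q0x.2.1; first exact: kmin.
  exact: le_trans kq0 q0q.
have /choice[f fP] (l : seq X) : exists x, [/\ E x, below (r (size l)) x &
    forall y, y \in l -> (exists q, leaves y q) -> ~ below (k y) x].
  have [|x Ex [rx kx]] := HE (size l) [seq k y | y <- l & `[< exists q, leaves y q >]].
    move=> q /mapP[y]; rewrite mem_filter => /andP[/asboolP /kP[[Pk [_ nk]] _] _ ->].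
    by split.
  exists x; split=> // y yl ly; apply: kx; apply/mapP; exists y => //.
  by rewrite mem_filter yl andbT; exact/asboolP.
pose L := fix L n := if n is m.+1 then f (L m) :: L m else [::].
have sizeL n : size (L n) = n by elim: n => //= n ->.
have inL n m : (n < m)%N -> f (L n) \in L m.
  elim: m => // m IH; rewrite ltnS leq_eqVlt => /predU1P[->|/IH] /=.
    exact: mem_head.
  by rewrite inE orbC => ->.
exists (fun n => f (L n)); first by move=> n; have [] := fP (L n).
move=> q Pq; split=> [qp|nqp].
  have [n nq] := rcof _ Pq qp; exists n => m nm.
  have [_ rm _] := fP (L m); apply: (below_le (nq _ nm)).
  by rewrite sizeL in rm.
have once n m : (n < m)%N -> below q (f (L n)) -> below q (f (L m)) -> False.
  move=> nm qn qm; have lq : leaves (f (L n)) q by [].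
  have [_ kmin] := kP _ (ex_intro _ q lq).
  have [_ _ /(_ _ (inL _ _ nm) (ex_intro _ q lq))] := fP (L m).
  by apply; apply: below_le (kmin _ lq) qm.
have [[n qn]|none] := pselect (exists n, below q (f (L n))); last first.
  by exists 0%N => m _ qm; apply: none; exists m.
by exists n.+1 => m nm; exact: (once n).
Qed.
End Frechet.


Lemma sigma_closure_seq (E : set T) p :
  closure (E : set (sigma_coarse_wedge T)) p ->
  exists2 e : nat -> T, (forall n, E (e n)) &
    forall q, ~ cf_omega q -> (q <= p -> exists n, forall m, (n <= m)%N -> q <= e m) /\
      (~ q <= p -> exists n, forall m, (n <= m)%N -> ~ q <= e m).
Proof.
move=> clE; have [r [rP rcof]] := node_sequence treeT p.
apply: (@trace_frechet T (fun q x => q <= x) [set q | ~ cf_omega q] _ _ p r E) => //.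
- by move=> q q' x; exact: le_trans.
- by move=> q q' x; exact: tree_total.
- by move=> n; have [] := rP n.
move=> n l lP.
have [|x [Ex [rx lx]]] := clE [set x | r n <= x /\ forall q, q \in l -> ~ q <= x].
  apply: (@filterI _ (nbhs (p : sigma_coarse_wedge T))).
    apply: open_nbhs_nbhs; split; last exact: (rP n).2.
    exact/sigma_wedge_open/(rP n).1.
  elim: l lP => [|q l IH] lP.
    by apply: (@filterE _ (nbhs (p : sigma_coarse_wedge T))).
  have np : nbhs (p : sigma_coarse_wedge T) (~` wedge q).
    apply: open_nbhs_nbhs; have [qn qp] := lP _ (mem_head _ _).
    by split; [exact: sigma_wedgeC_open | exact: qp].
  have {}IH := IH (fun q' q'l => lP q' (mem_behead (s := q :: l) q'l)).
  apply: (@filterS2 _ (nbhs (p : sigma_coarse_wedge T)) _ _ _ _ _ np IH) => x qx lx q'.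
  by rewrite inE => /predU1P[->|]; [exact: qx | exact: lx].
by exists x.
Qed.

End Nodes.
End TreeTopology.

(** * The tree with separated limits *)

Section HatTree.
Context {d : Order.disp_t} {T : porderType d}.
Hypothesis treeT : is_tree T.
Hypothesis completeT : chain_complete T.
Implicit Types (s t q : T) (x y z : hat T).

Definition hat_proj x : T := match x with hat_base t => t | hat_sep t _ => t end.

Lemma hat_proj_le x y : x <= y -> hat_proj x <= hat_proj y.
Proof. by case: x y => [s|s hs] [t|t ht] //; exact: ltW. Qed.

Lemma hat_sep_limit t (h : cf_uncountable t) : limit_height t /\ ~ cf_omega t.
Proof. exact/cf_uncountableP. Qed.

Lemma hat_total x y z : x <= z -> y <= z -> x <= y \/ y <= x.
Proof.
move=> /hat_proj_le xz /hat_proj_le yz.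
wlog xy : x y xz yz / hat_proj x <= hat_proj y.
  move=> W; have [xy|yx] := tree_total treeT xz yz; first exact: W.
  by have [|] := W y x yz xz yx; [right|left].
case: x y xz yz xy => [s|s hs] [t|t ht] /= _ _ xy; [by left| |by left|by left].
by move: xy; rewrite le_eqVlt => /predU1P[->|]; [right; exact: (lexx t)|left].
Qed.

Lemma hat_cf_finiteP x : cf_finite x <-> ~ limit_height x.
Proof. by apply: cf_finiteP => y z /ltW yx /ltW zx; exact: hat_total yx zx. Qed.

Lemma hat_base_lt s t : (hat_base s < hat_base t) = (s < t).
Proof. by rewrite !lt_leAnge. Qed.

Lemma hat_base_lt_sep s t (h : cf_uncountable t) : (hat_base s < hat_sep h) = (s < t).
Proof.
rewrite lt_leAnge; change ((s < t) && ~~ (t <= s) = (s < t)).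
by rewrite lt_leAnge; case: (s <= t) => //=; case: (t <= s).
Qed.

Lemma hat_sep_lt_base s (h : cf_uncountable s) t :
  (hat_sep h < hat_base t) = (s <= t).
Proof.
rewrite lt_leAnge; change ((s <= t) && ~~ (t < s) = (s <= t)).
have [st|//] := boolP (s <= t); rewrite /=; apply/negP => /(le_lt_trans st).
by rewrite ltxx.
Qed.

Lemma hat_sep_lt s t (hs : cf_uncountable s) (ht : cf_uncountable t) :
  (hat_sep hs < hat_sep ht) = (s < t).
Proof. by rewrite !lt_leAnge. Qed.

Lemma limit_next t m : limit_height t -> m < t -> exists2 s, s < t & ~ s <= m.
Proof.
move=> lim mt; apply: contrapT => H; apply: lim.2; exists m => // s st.
by apply: contrapT => nsm; apply: H; exists s.
Qed.

(** In [hat T] a node of uncountable cofinality becomes the successor of its new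
    point, so only the nodes of cofinality omega remain limits among the old
    ones; hence the coarse wedge topology of [hat T] induces on [T] the countably
    coarse one. *)
Lemma hat_base_limitP t : limit_height (hat_base t) <-> cf_omega t.
Proof.
split=> [lim|om]; last first.
  have lim := cf_omega_limit treeT om; split.
    by have [[s st] _] := lim; exists (hat_base s); rewrite /predecessors /= hat_base_lt.
  move=> [[m|m h]]; rewrite /predecessors /=.
    rewrite hat_base_lt => mt ub; have [s st nsm] := limit_next lim mt.
    by apply: nsm; apply: (ub (hat_base s)); rewrite /= hat_base_lt.
  rewrite hat_sep_lt_base le_eqVlt => /predU1P[e|mt] ub.
    by have [_] := hat_sep_limit h; rewrite e.
  by have := ub (hat_base m); rewrite /= hat_base_lt mt => /(_ isT) /=;
     change (m < m -> False); rewrite ltxx.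
apply: contrapT => nom.
have [limt|nlimt] := pselect (limit_height t).
  have h : cf_uncountable t by exact/cf_uncountableP.
  apply: lim.2; exists (hat_sep h); first by rewrite /predecessors /= hat_sep_lt_base.
  by move=> [s|s hs]; rewrite /predecessors /= ?hat_base_lt ?hat_sep_lt_base.
apply: lim.2; have [[x xt] _] := lim.
have sep_lt s (hs : cf_uncountable s) : s <= t -> s < t.
  rewrite le_eqVlt => /predU1P[e|//]; exfalso; apply: nlimt; rewrite -e.
  by have [] := hat_sep_limit hs.
have [s st] : predecessors t !=set0.
  move: xt; rewrite /predecessors /=; case: x => [s|s hs].
    by rewrite hat_base_lt; exists s.
  by rewrite hat_sep_lt_base => /(sep_lt _ hs); exists s.
have [m mt mub] : exists2 m, predecessors t m & ubound (predecessors t) m.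
  by apply: contrapT => H; apply: nlimt; split=> //; exists s.
exists (hat_base m); first by rewrite /predecessors /= hat_base_lt.
move=> [u|u hu]; rewrite /predecessors /= ?hat_base_lt ?hat_sep_lt_base.
  exact: mub.
by move=> /(sep_lt _ hu); exact: mub.
Qed.

Lemma hat_sep_limitP t (h : cf_uncountable t) : limit_height (hat_sep h).
Proof.
have [lim _] := hat_sep_limit h; split.
  by have [[s st] _] := lim; exists (hat_base s); rewrite /predecessors /= hat_base_lt_sep.
move=> [[m|m hm]]; rewrite /predecessors /=.
  rewrite hat_base_lt_sep => mt ub; have [s st nsm] := limit_next lim mt.
  by apply: nsm; apply: (ub (hat_base s)); rewrite /= hat_base_lt_sep.
rewrite hat_sep_lt => mt ub.
by have := ub (hat_base m); rewrite /= hat_base_lt_sep mt => /(_ isT) /=;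
   change (m < m -> False); rewrite ltxx.
Qed.

Lemma hat_cvg (F : set_system (hat T)) z : Filter F ->
  (forall q, ~ cf_omega q -> hat_base q <= z -> F [set x | hat_base q <= x]) ->
  (forall q, ~ cf_omega q -> ~ hat_base q <= z -> F [set x | ~ hat_base q <= x]) ->
  F --> (z : coarse_wedge (hat T)).
Proof.
move=> FF Fin Fout; apply: wedge_cvg => -[q|q h] /hat_cf_finiteP H.
- by apply: Fin; move=> /hat_base_limitP.
- by exfalso; apply: H; exact: hat_sep_limitP.
- by apply: Fout; move=> /hat_base_limitP.
- by exfalso; apply: H; exact: hat_sep_limitP.
Qed.

Lemma hat_open q : ~ cf_omega q ->
  open ([set x | hat_base q <= x] : set (coarse_wedge (hat T))).
Proof.
by move=> nom; apply: wedge_open; apply/hat_cf_finiteP => /hat_base_limitP.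
Qed.

Lemma hatC_open q : ~ cf_omega q ->
  open ([set x | ~ hat_base q <= x] : set (coarse_wedge (hat T))).
Proof.
by move=> nom; apply: wedgeC_open; apply/hat_cf_finiteP => /hat_base_limitP.
Qed.

Lemma not_limit_nomega q : ~ limit_height q -> ~ cf_omega q.
Proof. by move=> nl /(cf_omega_limit treeT). Qed.

Lemma limit_node_lt q t : limit_height t -> ~ limit_height q -> (q <= t) = (q < t).
Proof.
move=> lim nl; rewrite le_eqVlt; have [e|//] := eqVneq q t.
by exfalso; apply: nl; rewrite e.
Qed.

(** Points of [hat T] are determined by the chains of clopen wedges containing
    them. *)
Lemma hat_eq x y : (forall q, ~ cf_omega q -> hat_base q <= x <-> hat_base q <= y) -> x = y.
Proof.
wlog : x y / (if x is hat_base _ then True else if y is hat_base _ then False else True).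
  by move=> W; case: x y => [s|s hs] [t|t ht] H; [exact: W|exact: W| |exact: W];
     symmetry; apply: W => // q /H[? ?]; split.
case: x y => [s|s hs] [t|t ht] // _ H.
- congr hat_base; apply: (eq_nodes treeT completeT) => q nl.
  exact: (H _ (not_limit_nomega nl)).
- have [lim nom] := hat_sep_limit ht.
  have st : s = t.
    apply: (eq_nodes treeT completeT) => q nl; rewrite (limit_node_lt lim nl).
    exact: (H _ (not_limit_nomega nl)).
  by subst s; have [/(_ (lexx t)) tt _] := H _ nom; move: (tt : t < t); rewrite ltxx.
- have [lims _] := hat_sep_limit hs; have [limt _] := hat_sep_limit ht.
  have st : s = t.
    apply: (eq_nodes treeT completeT) => q nl.
    rewrite (limit_node_lt lims nl) (limit_node_lt limt nl).
    exact: (H _ (not_limit_nomega nl)).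
  by subst s; congr hat_sep; exact: Prop_irrelevance.
Qed.

Lemma hat_base_le q q' x : q <= q' -> hat_base q' <= x -> hat_base q <= x.
Proof. by move=> qq'; apply: (@le_trans _ _ (hat_base q')). Qed.

Lemma hat_base_total q q' x : hat_base q <= x -> hat_base q' <= x -> q <= q' \/ q' <= q.
Proof. by move=> /hat_proj_le /= qx /hat_proj_le /=; exact: tree_total qx. Qed.

Hypothesis rootedT : rooted T.

(** The nodes whose wedges belong to an ultrafilter form a chain, and the
    ultrafilter converges to its supremum [p], or to the new point just below [p]
    when the wedge of [p] itself is not in the ultrafilter and [p] has uncountable
    cofinality. *)
Lemma hat_compact : compact [set: coarse_wedge (hat T)].
Proof.
rewrite compact_ultra => F FU _.
pose S := [set q | ~ cf_omega q /\ F [set x | hat_base q <= x]].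
have [r rP] := tree_root treeT rootedT.
have Sr : S r.
  split; first by apply: not_limit_nomega; exact: root_not_limit.
  by apply: filterE => x; case: x => [t|t h]; [exact: rP|];
     change (r < t); have [lim _] := hat_sep_limit h;
     rewrite -limit_node_lt //; exact: root_not_limit.
have [|p [pub pleast]] := completeT (A := S).
  move=> q q' [_ Fq] [_ Fq'].
  have [x [qx q'x]] := filter_ex (filterI Fq Fq').
  exact: hat_base_total qx q'x.
have Slt q : q < p -> F [set x | hat_base q <= x].
  move=> qp; have [s Ss nsq] : exists2 s, S s & ~ s <= q.
    apply: contrapT => H; suff : p <= q by move=> /(lt_le_trans qp); rewrite ltxx.
    by apply: pleast => s Ss; apply: contrapT => nsq; apply: H; exists s.
  have [sq|qs] := tree_total treeT (pub _ Ss) (ltW qp); first by [].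
  by apply: filterS Ss.2 => x; exact: hat_base_le.
have conv z : (forall q, ~ cf_omega q -> hat_base q <= z -> F [set x | hat_base q <= x]) ->
    (forall q, S q -> hat_base q <= z) -> F --> (z : coarse_wedge (hat T)).
  move=> H1 H2; apply: hat_cvg => // q nom nz.
  have [Fq|Fq] := in_ultra_setVsetC [set x | hat_base q <= x] FU; last exact: Fq.
  by exfalso; apply: nz; exact: H2.
have [pS|npS] := pselect (S p \/ cf_omega p).
  exists (hat_base p); split => //; apply: conv => [q nom|q Sq]; last exact: pub.
  change (q <= p -> F [set x | hat_base q <= x]); rewrite le_eqVlt => /predU1P[e|].
    by case: pS => [[_]|]; rewrite -e.
  exact: Slt.
have limp : limit_height p.
  split.
    exists r; rewrite /predecessors /= lt_neqAle rP andbT; apply/eqP => e.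
    by apply: npS; left; rewrite -e.
  move=> [m mp mub]; suff : p <= m by move=> /(lt_le_trans mp); rewrite ltxx.
  apply: pleast => s Ss; apply: mub; rewrite /predecessors /= lt_neqAle (pub _ Ss) andbT.
  by apply/eqP => e; apply: npS; left; rewrite -e.
have h : cf_uncountable p.
  by apply/(cf_uncountableP treeT); split=> // om; apply: npS; right.
exists (hat_sep h); split=> //; apply: conv => [q _|q Sq]; first exact: Slt.
change (q < p); rewrite lt_neqAle (pub _ Sq) andbT.
by apply/eqP => e; apply: npS; left; rewrite -e.
Qed.

Lemma hat_sep_approx t (h : cf_uncountable t) (B : set (hat T)) s :
  nbhs (hat_sep h : coarse_wedge (hat T)) B -> s < t ->
  exists r, [/\ s <= r, r < t & B (hat_base r)].
Proof.
move=> hB st; have [lim _] := hat_sep_limit h.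
pose F := filter_from (predecessors t)
  (fun u => [set x | exists2 r, u <= r < t & x = hat_base r]).
have FF : ProperFilter F.
  apply: filter_from_proper; first apply: filter_from_filter.
  - by exists s.
  - move=> u v ut vt; have [uv|vu] := tree_total treeT (ltW ut) (ltW vt).
      exists v => // x [r /andP[vr rt] ->]; split; exists r => //.
        by rewrite (le_trans uv) // rt.
      by rewrite vr.
    exists u => // x [r /andP[ur rt] ->]; split; exists r => //.
      by rewrite ur.
    by rewrite (le_trans vu) // rt.
  - by move=> u ut; exists (hat_base u), u => //; rewrite lexx.
have Fh : F --> (hat_sep h : coarse_wedge (hat T)).
  apply: hat_cvg => q nom qt.
    exists q => // x [r /andP[qr _] ->]; exact: qr.
  exists s => // x [r /andP[_ rt] ->] qr; apply: qt.
  change (q < t); exact: le_lt_trans rt.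
have [u ut uB] := Fh _ hB.
have [su|us] := tree_total treeT (ltW st) (ltW ut).
  by exists u; split=> //; apply: uB; exists u => //; rewrite lexx.
by exists s; split=> //; apply: uB; exists s => //; rewrite us.
Qed.

End HatTree.

(** * From Valdivia to weakly Corson *)

Section ValdiviaWeaklyCorson.
Context {R : realType} {d : Order.disp_t} {T : porderType d}.
Hypothesis treeT : is_tree T.
Hypothesis completeT : chain_complete T.

Lemma coarse_wedge_hausdorff : hausdorff_space (coarse_wedge T).
Proof.
move=> a b ab; apply: (eq_nodes treeT completeT) => q /(tree_cf_finiteP treeT) qf.
have sep (u v : T) : cluster (nbhs (u : coarse_wedge T)) v -> q <= u -> q <= v.
  move=> uv qu; apply: contrapT => nqv.
  have [||x [qx nqx]] := uv (wedge q) (~` wedge q).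
  - by apply: open_nbhs_nbhs; split=> //; exact: wedge_open.
  - by apply: open_nbhs_nbhs; split=> //; exact: wedgeC_open.
  - exact: nqx.
split; first exact: sep.
by apply: sep => A B bA aB; rewrite setIC; exact: ab.
Qed.

Lemma node_hat_proj q (x : hat T) : ~ limit_height q ->
  (q <= hat_proj x) = (hat_base q <= x).
Proof.
move=> nl; case: x => [t|t h] //=; have [lim _] := hat_sep_limit treeT h.
by rewrite (limit_node_lt lim nl).
Qed.

(** Collapsing each new point onto the node above it is continuous, because the
    clopen wedges of [T] are based at successors, which see no difference between
    the two ([node_hat_proj]). *)
Lemma hat_proj_continuous :
  continuous (@hat_proj d T : coarse_wedge (hat T) -> coarse_wedge T).
Proof.
move=> x; have FF : Filter (@hat_proj d T @ nbhs (x : coarse_wedge (hat T))).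
  exact: fmap_filter.
apply: (wedge_cvg FF) => q /(tree_cf_finiteP treeT) nl;
  rewrite (node_hat_proj _ nl) => qx; apply: open_nbhs_nbhs; split.
- have -> : @hat_proj d T @^-1` wedge q = [set y | hat_base q <= y].
    by apply/seteqP; split=> y; rewrite /wedge /= node_hat_proj.
  exact/hat_open/not_limit_nomega.
- by move: qx; rewrite -node_hat_proj.
- have -> : @hat_proj d T @^-1` (~` wedge q) = [set y | ~ hat_base q <= y].
    by apply/seteqP; split=> y; rewrite /wedge /= node_hat_proj.
  exact/hatC_open/not_limit_nomega.
- by move: qx; rewrite -node_hat_proj.
Qed.

Lemma dense_hat_seq (D : set (coarse_wedge (hat T))) t : dense D ->
  exists2 e : nat -> coarse_wedge (hat T), (forall n, D (e n)) &
    e @ \oo --> (hat_base t : coarse_wedge (hat T)).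
Proof.
move=> Ddense; have [r [rP rcof]] := node_sequence treeT t.
have [||||n l lP|e eD elim] := @trace_frechet d T treeT (hat T)
  (fun q x => hat_base q <= x) [set q | ~ cf_omega q] _ _ (hat_base t) r D.
- by move=> q q' x; exact: hat_base_le.
- by move=> q q' x; exact: hat_base_total.
- by move=> n; have [] := rP n.
- exact: rcof.
- have [||x [[rx lx] Dx]] := Ddense ([set x | hat_base (r n) <= x] `&`
      [set x | forall q, q \in l -> ~ hat_base q <= x]).
  + by exists (hat_base t); split; [exact: (rP n).2|move=> q /lP[]].
  + apply: openI; first exact/hat_open/(rP n).1.
    elim: l lP => [|q l IH] lP.
      by rewrite (_ : [set x | _] = setT); [exact: openT|apply/seteqP; split].
    have {}IH := IH (fun q' q'l => lP q' (mem_behead (s := q :: l) q'l)).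
    rewrite (_ : [set x | _] = [set x | ~ hat_base q <= x] `&`
      [set x | forall q', q' \in l -> ~ hat_base q' <= x]).
      by apply: openI IH; apply: hatC_open => //; exact: (lP _ (mem_head _ _)).1.
    apply/seteqP; split=> [x H|x [qx H] q'].
      by split; [apply: H; exact: mem_head|move=> q' q'l; apply: H; rewrite inE q'l orbT].
    by rewrite inE => /predU1P[->|/H].
  + by exists x.
exists e => //; apply: hat_cvg => // q nom qt.
  by have [n nP] := (elim _ nom).1 qt; exists n => // m /= /nP.
by have [n nP] := (elim _ nom).2 qt; exists n => // m /= /nP.
Qed.

(** The points of [hat T] whose image has countable support are closed under
    limits of sequences, so by [dense_hat_seq] they include all of [T]. They form
    a Corson countably compact space that [hat_proj] maps onto [T]. *)
Lemma valdivia_weakly_corson : valdivia_compact R (coarse_wedge (hat T)) ->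
  weakly_corson_compact R (coarse_wedge T).
Proof.
move=> [hat_cpt [G]]; elim/Pchoice: G => G [h [[h_inj h_open] h_cube h_dense]].
have h_cont : continuous h by apply/continuousP => V Vo; apply/h_open; exists V.
have range_cpt : compact (range h).
  by apply: continuous_compact hat_cpt; exact: continuous_subspaceT.
pose A := range h `&` @Sigma R G.
have base_sigma t : @Sigma R G (h (hat_base t)).
  split; first by apply: h_cube; exists (hat_base t).
  have [e eD et] := dense_hat_seq t h_dense.
  apply: (@sub_countable _ _ _ (\bigcup_n supp (h (e n)))).
    apply: subset_card_le; apply: sublimit_supp; exists \oo; split.
    - exact: eventually_filter.
    - by move=> n; exact: nbhs_infty_ge.
    - by apply: cvg_comp et _; exact: h_cont.
  by apply: bigcup_countable => [|n _]; [exact: countableP | exact: (eD n).2].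
have A_cc : countably_compact A.
  apply: sublimit_countably_compact => e eA.
  have [x xr ex] := compact_sublimit range_cpt (fun n => (eA n).1).
  exists x; last by [].
  split; first by [].
  split; first exact: h_cube.
  apply: (@sub_countable _ _ _ (\bigcup_n supp (e n))).
    by apply: subset_card_le; exact: sublimit_supp.
  by apply: bigcup_countable => [|n _]; [exact: countableP | exact: (eA n).2.2].
have /choice[k kP] (a : set_type A) : exists x, h x = set_val a.
  by have [[x _ xa] _] : A (set_val a) := set_valP a; exists x.
split.
- have -> : [set: coarse_wedge T] = @hat_proj d T @` [set: coarse_wedge (hat T)].
    by apply/seteqP; split=> t // _; exists (hat_base t).
  apply: continuous_compact hat_cpt.
  exact/continuous_subspaceT/hat_proj_continuous.
- exact: coarse_wedge_hausdorff.
exists (set_type A), (fun a => hat_proj (k a)); split.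
- exists G, A; split=> [x []//|//|].
  by exists id, id; split=> // x; exact: cvg_id.
- move=> a; apply: (@cvg_comp _ _ _ k (@hat_proj d T) _ (nbhs (k a : coarse_wedge (hat T))));
    last exact: hat_proj_continuous.
  move=> U Uka; have [V [Vo Va] VU] : exists2 V, open_nbhs (k a : coarse_wedge (hat T)) V & V `<=` U.
    by move: Uka; rewrite -[X in X -> _]/(nbhs (k a : coarse_wedge (hat T)) U) nbhsE.
  have [W Wo WV] := (h_open V).1 Vo.
  rewrite /nbhs /=.
  exists (set_val @^-1` W).
  split; [by exists W| |].
    by rewrite /= -kP; change ((h @^-1` W) (k a)); rewrite WV.
  by move=> b /= Wb; apply: VU; rewrite -WV /= kP.
- apply/seteqP; split=> // t _.
  have At : A (h (hat_base t)) by split=> //; exists (hat_base t).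
  exists (SigSub (mem_set At)) => //; have := kP (SigSub (mem_set At)).
  by move=> /h_inj ->.
Qed.

End ValdiviaWeaklyCorson.

(** * From Corson countably compact to Valdivia *)

Section CorsonValdivia.
Context {R : realType} {d : Order.disp_t} {T : porderType d}.
Hypothesis treeT : is_tree T.
Hypothesis completeT : chain_complete T.
Hypothesis rootedT : rooted T.
Local Open Scope ring_scope.
Local Open Scope order_scope.

(** The supremum [c] of the [r n] has cofinality omega, so it has no wedge of its
    own in the subbase, and points that leave the branch of [c] between [r n] and
    [r n.+1] converge to it. *)
Lemma branching_cvg (t : T) (r : nat -> T) : limit_height t -> ~ cf_omega t ->
  (forall n, r n < r n.+1) -> (forall n, r n < t) ->
  exists c : T, forall x : nat -> T,
    (forall n, r n <= x n) -> (forall n, ~ r n.+1 <= x n) ->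
    x @ \oo --> (c : sigma_coarse_wedge T).
Proof.
move=> lim nom rlt rt.
have rmono n m : (n <= m)%N -> r n <= r m.
  move=> /subnK <-; elim: (m - n)%N => [|i IH]; first exact: lexx.
  rewrite addSn; exact: le_trans IH (ltW (rlt _)).
have [|c [cub cleast]] := completeT (A := range r).
  by move=> _ _ [n _ <-] [m _ <-]; exact: tree_total (ltW (rt n)) (ltW (rt m)).
have rc n : r n < c by apply: lt_le_trans (rlt n) _; apply: cub; exists n.+1.
have below_c q : ~ cf_omega q -> q <= c -> exists n, q <= r n.
  move=> nomq qc; apply: contrapT => H.
  have rq n : r n < q.
    rewrite lt_neqAle; apply/andP; split.
      by apply/eqP => e; apply: H; exists n; rewrite e.
    by have [//|qr] := tree_total treeT (ltW (rc n)) qc; exfalso; apply: H; exists n.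
  have eqc : q = c.
    apply/le_anti; rewrite qc /=; apply: cleast => _ [n _ <-]; exact: ltW.
  apply: nomq; rewrite eqc; apply/(cf_omegaP treeT); split.
    split; first by exists (r 0%N); exact: rc.
    move=> [m mc mub]; suff : c <= m by move=> /(lt_le_trans mc); rewrite ltxx.
    by apply: cleast => _ [n _ <-]; apply: mub; exact: rc.
  exists (range r); last by apply: countable_image; exact: countableP.
  split=> [_ [n _ <-]|s sc]; first exact: rc.
  have [n nsr] : exists n, ~ r n <= s.
    apply: contrapT => H'; suff : c <= s by move=> /(lt_le_trans sc); rewrite ltxx.
    by apply: cleast => _ [n _ <-]; apply: contrapT => ns; apply: H'; exists n.
  exists (r n); first by exists n.
  by have [|//] := tree_total treeT (ltW (rc n)) (ltW sc).
exists c => x rx nrx; apply: sigma_wedge_cvg => q nomq qc.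
  have [n qr] := below_c _ nomq qc; exists n => // m /= nm.
  by rewrite /wedge /=; exact: le_trans qr (le_trans (rmono _ _ nm) (rx m)).
have once n m : (n < m)%N -> q <= x n -> q <= x m -> False.
  move=> nm qn qm; have [qr|rq] := tree_total treeT qm (le_trans (rmono _ _ nm) (rx m)).
    by apply: qc; exact: le_trans qr (ltW (rc _)).
  by apply: (nrx n); exact: le_trans rq qn.
have [[n qn]|none] := pselect (exists n, q <= x n); last first.
  by exists 0%N => // m _; apply/negP/negP => qm; apply: none; exists m.
by exists n.+1 => // m nm; apply/negP/negP; exact: (once n m).
Qed.

(** If the oscillation of [u] stayed above [eps] all the way up to [t], two
    sequences would branch off as in [branching_cvg], share their limit, and yet
    keep their values [eps] apart. Countably many bounds for [eps] then combine
    below [t] by [sequence_bounded]. *)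
Lemma eventually_constant (t : T) (u : sigma_coarse_wedge T -> R) :
  limit_height t -> ~ cf_omega t -> continuous u ->
  exists2 r, r < t & forall x y, r <= x -> ~ t <= x -> r <= y -> ~ t <= y -> u x = u y.
Proof.
move=> lim nom ucont.
have small (eps : R) : 0 < eps -> exists2 r, r < t & forall x y,
    r <= x -> ~ t <= x -> r <= y -> ~ t <= y -> `|u x - u y| < eps.
  move=> eps0; apply: contrapT => H.
  have miss x : ~ t <= x -> exists2 s, s < t & ~ s <= x.
    move=> tx; apply: contrapT => H'; apply: tx; apply: (limit_le treeT completeT lim).
    by move=> s st; apply: contrapT => ns; apply: H'; exists s.
  have /choice[c cP] r : exists c : T * T * T, r < t ->
      [/\ r <= c.1.1, r <= c.1.2, r < c.2 < t, ~ c.2 <= c.1.1 /\ ~ c.2 <= c.1.2 &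
        eps <= `|u c.1.1 - u c.1.2|].
    have [rt|] := pselect (r < t); last by exists (r, r, r).
    have [x [y [[rx tx] [ry ty] xy]]] : exists x y, [/\ r <= x /\ ~ t <= x,
        r <= y /\ ~ t <= y & eps <= `|u x - u y|].
      apply: contrapT => H'; apply: H; exists r => // x y rx tx ry ty.
      by rewrite ltNge; apply/negP => xy; apply: H'; exists x, y.
    have [s st sx] := miss _ tx; have [s' s't s'y] := miss _ ty.
    have [k [rk kt _]] := successor_below_limit treeT lim rt.
    have [|||m mt mP] := @finite_chain_bounded _ _ t [:: s; s'; k].
    - by move=> a b /ltW at' /ltW bt; exact: tree_total at' bt.
    - exact: lim.
    - by move=> a; rewrite !inE => /or3P[] /eqP ->.
    exists (x, y, m) => _ /=; split=> //.
      by rewrite mt andbT (lt_le_trans rk) // mP // !inE eqxx !orbT.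
    split=> [mx|my]; [apply: sx|apply: s'y].
      by apply: le_trans mx; apply: mP; rewrite !inE eqxx.
    by apply: le_trans my; apply: mP; rewrite !inE eqxx orbT.
  have [[s0 s0t] _] := lim.
  pose r := fix r n := if n is m.+1 then (c (r m)).2 else s0.
  have rt n : r n < t.
    elim: n => [//|n /= /cP[_ _ /andP[_ ct] _ _]]; exact: ct.
  have rlt n : r n < r n.+1 by have [_ _ /andP[]] := cP _ (rt n).
  have [p pP] := branching_cvg lim nom rlt rt.
  pose x n := (c (r n)).1.1; pose y n := (c (r n)).1.2.
  have xp : x @ \oo --> (p : sigma_coarse_wedge T).
    by apply: pP => n; have [? ? _ [] ? ? _] := cP _ (rt n).
  have yp : y @ \oo --> (p : sigma_coarse_wedge T).
    by apply: pP => n; have [? ? _ [] ? ? _] := cP _ (rt n).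
  have ux : (u \o x) @ \oo --> u p by apply: cvg_comp xp _; exact: ucont.
  have uy : (u \o y) @ \oo --> u p by apply: cvg_comp yp _; exact: ucont.
  have e2 : 0 < eps / 2 by rewrite divr_gt0.
  have /cvgrPdist_lt/(_ _ e2) ux' := ux; have /cvgrPdist_lt/(_ _ e2) uy' := uy.
  have [n [/= xn yn]] := filter_ex (filterI ux' uy').
  have [_ _ _ _] := cP _ (rt n); rewrite leNgt => /negP; apply.
  rewrite (splitr eps); apply: le_lt_trans (ltrD xn yn); rewrite [X in _ <= X + _]distrC.
  by rewrite -[X in `|X|](subrKA (u p)) ler_normD.
have /choice[r rP] (n : nat) : exists r, r < t /\ forall x y,
    r <= x -> ~ t <= x -> r <= y -> ~ t <= y -> `|u x - u y| < n.+1%:R^-1.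
  by have [|r rt rP] := small n.+1%:R^-1; [rewrite invr_gt0 ltr0n|exists r].
have [s st sP] := sequence_bounded treeT lim nom (fun n => (rP n).1).
exists s => // x y sx tx sy ty; apply/eqP; rewrite -subr_eq0 -normr_le0 leNgt.
apply/negP => xy; have [n _ nP] := near_infty_natSinv_lt (PosNum xy).
have := nP n (leqnn n); rewrite /= ltNge => /negP; apply; apply: ltW.
by apply: (rP n).2 => //; 
  [exact: le_trans (ltW (sP n)) sx|exact: le_trans (ltW (sP n)) sy].
Qed.

Lemma hat_base_dense (z : hat T) (B : set (hat T)) :
  nbhs (z : coarse_wedge (hat T)) B -> exists x, B (hat_base x).
Proof.
case: z => [t|t h] zB; first by exists t; exact: nbhs_singleton zB.
have [[[s st] _] _] := hat_sep_limit treeT h.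
by have [r [_ _ Br]] := hat_sep_approx treeT zB st; exists r.
Qed.

Lemma hat_base_nbhs (t : T) (P : set T) : nbhs (t : sigma_coarse_wedge T) P ->
  exists2 B, nbhs (hat_base t : coarse_wedge (hat T)) B & forall x, B (hat_base x) -> P x.
Proof.
move=> tP.
pose F := filter_from (nbhs (hat_base t : coarse_wedge (hat T)))
  (fun B => [set x | B (hat_base x)]).
have FF : Filter F.
  apply: filter_from_filter; first by exists setT; exact: filterT.
  move=> B C tB tC; exists (B `&` C); last by [].
  exact: (@filterI _ (nbhs (hat_base t : coarse_wedge (hat T)))).
have Ft : F --> (t : sigma_coarse_wedge T).
  apply: sigma_wedge_cvg => q nom qt.
    exists [set x | hat_base q <= x]; last by [].
    by apply: open_nbhs_nbhs; split=> //; exact: hat_open.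
  exists [set x | ~ hat_base q <= x]; last by [].
  by apply: open_nbhs_nbhs; split=> //; exact: hatC_open.
by have [B tB BP] := Ft _ tP; exists B.
Qed.

(** Each coordinate of the embedding of [T] is constant just below a limit [t] of
    uncountable cofinality, and its constant value is the only possible value at
    the new point. The extension is injective because complementary clopen pieces
    of [T] have images with disjoint closures. *)
Lemma corson_valdivia : corson_countably_compact R (sigma_coarse_wedge T) ->
  valdivia_compact R (coarse_wedge (hat T)).
Proof.
move=> [G]; elim/Pchoice: G => G [A [A_Sigma A_cc [f [f' [fK f'K f_cont f'_cont]]]]].
have A_supp x : A x -> countable (supp x) by move=> /A_Sigma[].
pose h (t : T) : {ptws G -> R} := set_val (f t).
have hA t : A (h t) by exact: (set_valP (f t)).
have h_inj s t : h s = h t -> s = t.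
  by move=> /val_inj /(congr1 f'); rewrite !fK.
have h_cont g : continuous (fun t : sigma_coarse_wedge T => h t g).
  move=> t; apply: (@cvg_comp _ _ _ h (fun x : {ptws G -> R} => x g) _ (nbhs (h t)));
    last exact: ptws_eval.
  move=> U hU; apply: (f_cont t (fun a => U (set_val a))).
  by apply/set_type_nbhsP; exists U.
have pieces q : ~ cf_omega q ->
    rel_clopen A [set x | exists2 t, h t = x & q <= t].
  move=> nom x Ax; pose a : set_type A := SigSub (mem_set Ax).
  have side (Q : set T) : open (Q : set (sigma_coarse_wedge T)) -> Q (f' a) ->
      \forall y \near x, A y -> exists2 t, h t = y & Q t.
    move=> Qo Qa; have /set_type_nbhsP[W xW WQ] : nbhs a (f' @^-1` Q).
      by apply: (f'_cont a); exact: open_nbhs_nbhs.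
    apply: (@filterS _ (nbhs x) _ W) => // y Wy Ay.
    exists (f' (SigSub (mem_set Ay))); first by rewrite /h f'K.
    exact: (WQ (SigSub (mem_set Ay))).
  have ha : h (f' a) = x by rewrite /h f'K.
  have [qa|nqa] := pselect (q <= f' a).
    apply: filterS (side _ (sigma_wedge_open nom) qa) => y H Ay.
    by split=> _; [exists (f' a)|exact: H].
  apply: filterS (side _ (sigma_wedgeC_open nom) nqa) => y H Ay.
  split=> -[t ht qt]; exfalso.
    by have [s hs nqs] := H Ay; apply: nqs; rewrite (h_inj s t) ?hs ?ht.
  by apply: nqa; rewrite (h_inj (f' a) t) ?ha ?ht.
have /choice[rr rrP] (tg : T * G) : exists r, cf_uncountable tg.1 ->
    r < tg.1 /\ forall x y, r <= x -> ~ tg.1 <= x -> r <= y -> ~ tg.1 <= y ->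
      h x tg.2 = h y tg.2.
  have [ht|] := pselect (cf_uncountable tg.1); last by exists tg.1.
  have [lim nom] := hat_sep_limit treeT ht.
  by have [r rt rP] := eventually_constant lim nom (h_cont tg.2); exists r.
pose hh (z : hat T) : {ptws G -> R} := match z with
  | hat_base t => h t | hat_sep t _ => fun g => h (rr (t, g)) g end.
have hh_sep t (ht : cf_uncountable t) g x : rr (t, g) <= x -> ~ t <= x ->
    hh (hat_sep ht) g = h x g.
  move=> rx tx; have [rt rP] := rrP (t, g) ht; apply: rP => //=.
  by move=> /(lt_le_trans rt); rewrite ltxx.
have hh_cont : continuous (hh : coarse_wedge (hat T) -> {ptws G -> R}).
  move=> z; apply: (@ptws_cvg _ _ _ _ _ _ (nbhs_filter (z : coarse_wedge (hat T)))) => g P zP.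
  have [B zB BP] : exists2 B, nbhs (z : coarse_wedge (hat T)) B &
      forall x, B (hat_base x) -> P (h x g).
    case: z zP => [t|t ht] zP; first by apply: hat_base_nbhs; exact: h_cont.
    have [lim nom] := hat_sep_limit treeT ht; have [rt _] := rrP (t, g) ht.
    have [k [rk kt nl]] := successor_below_limit treeT lim rt.
    exists ([set x | hat_base k <= x] `&` [set x | ~ hat_base t <= x]).
      apply: open_nbhs_nbhs; split.
        by apply: openI; [exact/hat_open/not_limit_nomega|exact: hatC_open].
      by split=> //=; change (~ (t < t)); rewrite ltxx.
    move=> x [kx tx]; rewrite -(hh_sep _ ht); first exact: nbhs_singleton zP.
      exact: le_trans (ltW rk) kx.
    exact: tx.
  have [V [Vo Vz] VB] : exists2 V, open_nbhs (z : coarse_wedge (hat T)) V & V `<=` B.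
    by move: zB; rewrite nbhsE.
  change (nbhs (z : coarse_wedge (hat T)) [set y | P (hh y g)]).
  apply: (@filterS _ _ (nbhs_filter (z : coarse_wedge (hat T))) V); last exact: open_nbhs_nbhs.
  move=> [t|t ht] Vy; first by apply: BP; exact: VB.
  have [rt _] := rrP (t, g) ht.
  have hV : nbhs (hat_sep ht : coarse_wedge (hat T)) V by exact: open_nbhs_nbhs.
  have [s [rs st Vs]] := hat_sep_approx treeT hV rt.
  have ts : ~ t <= s by move=> /(lt_le_trans st); rewrite ltxx.
  change (P (hh (hat_sep ht) g)); rewrite (hh_sep _ ht g s rs ts).
  by apply: BP; exact: VB.
(* the old points are dense, so each value of hh is a limit of values of h *)
have hh_closure z (Q : set (hat T)) (S : set {ptws G -> R}) :
    open (Q : set (coarse_wedge (hat T))) -> Q z ->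
    (forall x, Q (hat_base x) -> S (h x)) -> closure (A `&` S) (hh z).
  move=> Qo Qz QS U hU.
  have [x [Ux Qx]] : exists x, U (h x) /\ Q (hat_base x).
    apply: (@hat_base_dense z [set y | U (hh y) /\ Q y]).
    apply: (@filterI _ (nbhs (z : coarse_wedge (hat T)))); first exact: hh_cont.
    exact: open_nbhs_nbhs.
  by exists (h x); split=> //; split=> //; exact: QS.
have hh_inj : injective hh.
  have sep y z q : hh y = hh z -> ~ cf_omega q -> hat_base q <= y -> hat_base q <= z.
    move=> yz nom qy; apply: contrapT => nqz.
    apply: (rel_clopen_disjoint_closure A_supp A_cc (pieces q nom) (x := hh y)).
      apply: (hh_closure _ [set x | hat_base q <= x]) => //; first exact: hat_open.
      by move=> x qx; exists x.
    rewrite yz; apply: (hh_closure _ [set x | ~ hat_base q <= x]) => //.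
      exact: hatC_open.
    by move=> x nqx [t ht qt]; apply: nqx; rewrite -(h_inj _ _ ht).
  by move=> y z yz; apply: (hat_eq treeT completeT) => q nom; split; exact: sep.
have cpt := hat_compact treeT completeT rootedT.
split=> //; exists G, hh; split.
- split=> // U; split=> [Uo|[V Vo <-]]; last by move/continuousP: hh_cont; exact.
  exists (~` (hh @` (~` U))).
    apply: closed_openC; apply: compact_closed; first exact: ptws_hausdorff.
    apply: continuous_compact; first exact: continuous_subspaceT.
    by apply: subclosed_compact cpt _ => //; exact: open_closedC.
  apply/seteqP; split=> z /=.
    by move=> nz; apply: contrapT => nU; apply: nz; exists z.
  move=> Uz; have nz : ~ (hh @` (~` U)) (hh z).
    by move=> [y nUy /hh_inj yz]; apply: nUy; rewrite yz.
  exact: nz.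
- move=> _ [[t|t ht] _ <-] g; first exact: (A_Sigma _ (hA t)).1.
  exact: (A_Sigma _ (hA (rr (t, g)))).1.
- move=> O [z Oz] Oo.
  have [x Ox] := hat_base_dense (open_nbhs_nbhs (conj Oo Oz)).
  by exists (hat_base x); split; [exact: Ox|exact: (A_Sigma _ (hA x))].
Qed.

End CorsonValdivia.

(** * Point-countable families from restrictions *)

Lemma exists_well_order (G : choiceType) : exists R : rel G,
  [/\ forall a b, R a b \/ R b a, forall a b, R a b -> R b a -> a = b,
    forall a b c, R a b -> R b c -> R a c &
    forall S : set G, S !=set0 -> exists2 m, S m & forall s, S s -> R m s].
Proof.
have [R wo] := well_ordering_principle G; exists R.
have least (S : set G) : S !=set0 -> exists2 m, S m & forall s, S s -> R m s.
  move=> [s Ss]; have [|m [[mS mle] _]] := wo [pred g | `[< S g >]].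
    by exists s; exact/asboolP.
  by exists m; [exact/asboolP|move=> g Sg; apply: mle; exact/asboolP].
have refl a : R a a.
  by have [|m -> mle] := least [set a]; [exists a|exact: mle].
have anti a b : R a b -> R b a -> a = b.
  move=> ab ba; have [|m [_ muniq]] := wo (pred2 a b); first by exists a; rewrite !inE eqxx.
  by rewrite -(muniq a) ?(muniq b) //; split; rewrite ?inE ?eqxx ?orbT // => x;
     rewrite !inE => /orP[] /eqP ->.
split=> //.
  move=> a b; have [|m [->|->] mle] := least [set a; b]; first by exists a; left.
    by left; apply: mle; right.
  by right; apply: mle; left.
move=> a b c ab bc.
have [|m [[->|mb]|mc] mle] := least [set a; b; c]; first by exists a; left; left.
- by apply: mle; right.
- by rewrite (anti a b) // -mb; apply: mle; left; left.
- by rewrite -(anti b c) // -mc; apply: mle; left; right.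
Qed.

Section RestrictionFamily.
Context {R : realType} {G : choiceType} {d : Order.disp_t} {T : porderType d}.
Local Notation E := {ptws G -> R}.
Local Open Scope ring_scope.

(** One representative for each list of integer parts of [n.+1 * x g]. *)
Lemma countable_approx (A : set E) (s : seq G) : exists2 D : set E,
  countable D & D `<=` A /\ forall x n, A x ->
    exists2 y, D y & forall g, g \in s -> `|y g - x g| < n.+1%:R^-1.
Proof.
pose key n (x : E) := [seq Num.floor (n.+1%:R * x g) | g <- s].
have /choice[rep repP] (nv : nat * seq int) : exists y, forall x, A x ->
    key nv.1 x = nv.2 -> A y /\ key nv.1 y = nv.2.
  have [[y [Ay yv]]|none] := pselect (exists y, A y /\ key nv.1 y = nv.2).
    by exists y.
  by exists point => x Ax xv; exfalso; apply: none; exists x.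
exists (A `&` range rep).
  apply: (@sub_countable _ _ _ (range rep)); first by apply: subset_card_le => x [].
  by apply: countable_image; exact: countableP.
split=> [x []//|x n Ax]; have [Ay ykey] := repP (n, key n x) x Ax erefl.
exists (rep (n, key n x)); first by split=> //; exists (n, key n x).
move=> g gs; set y := rep _ in ykey *.
have /eq_in_map/(_ g gs) : [seq Num.floor (n.+1%:R * y g) | g <- s] =
  [seq Num.floor (n.+1%:R * x g) | g <- s] by [].
have [/andP[y1 y2] /andP[x1 x2]] := (floor_itv (n.+1%:R * y g), floor_itv (n.+1%:R * x g)).
move=> e; rewrite e in y1 y2; rewrite !intrD in x2 y2.
rewrite -(ltr_pM2l (_ : 0 < n.+1%:R)) ?ltr0n // divff ?pnatr_eq0 //.
rewrite -[X in X * _]ger0_norm ?ler0n // -normrM mulrBr.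
rewrite ltr_norml; apply/andP; split; lra.
Qed.

Hypothesis treeT : is_tree T.
Hypothesis completeT : chain_complete T.
Variables (A : set E) (f : E -> T).
Hypothesis A_supp : forall x, A x -> countable (supp x).
Hypothesis A_cc : countably_compact A.
Hypothesis f_clopen : forall q, ~ limit_height q -> rel_clopen A [set x | (q <= f x)%O].
Local Open Scope order_scope.

(** For a limit [q] of uncountable cofinality the points of [A] mapped outside the
    wedge of [q] form an increasing union of uncountable length of clopen sets.
    It is closed under limits of sequences, hence closed by [sigma_frechet]. *)
Lemma f_clopen_node q : ~ cf_omega q -> rel_clopen A [set x | q <= f x].
Proof.
move=> nom; have [lim|] := pselect (limit_height q); last exact: f_clopen.
have miss x : ~ q <= f x -> exists2 s, s < q & ~ s <= f x.
  move=> qx; apply: contrapT => H; apply: qx; apply: (limit_le treeT completeT lim).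
  by move=> s sq; apply: contrapT => ns; apply: H; exists s.
move=> x Ax; have [qx|nqx] := pselect (q <= f x); last first.
  have [s sq nsx] := miss _ nqx.
  have [k [sk kq nl]] := successor_below_limit treeT lim sq.
  apply: filterS (f_clopen nl Ax) => y H Ay; split=> //= qy; exfalso.
  have /(H Ay) /= kx : k <= f y by exact: le_trans (ltW kq) qy.
  by apply: nsx; exact: le_trans (ltW sk) kx.
suff near_q : \forall y \near x, A y -> q <= f y.
  by apply: filterS near_q => y H Ay; split=> // _; exact: H.
apply: contrapT => nnear.
have [|||e eP ex] := @sigma_frechet R G (A `&` [set y | ~ q <= f y]) x.
- by move=> y [/A_supp].
- exact: A_supp.
- move=> U xU; apply: contrapT => H; apply: nnear; apply: filterS xU => y Uy Ay.
  by apply: contrapT => nqy; apply: H; exists y.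
have /choice[s sP] n : exists s, s < q /\ ~ s <= f (e n).
  by have [s sq ns] := miss _ (eP n).2; exists s.
have [u uq us] := sequence_bounded treeT lim nom (fun n => (sP n).1).
have [k [uk kq nl]] := successor_below_limit treeT lim uq.
pose U y := A y -> (k <= f y <-> k <= f x).
have nU : nbhs x U := f_clopen nl Ax.
have [n Un] : exists n, U (e n) by apply: (@filter_ex _ \oo); exact: ex.
have /(Un (eP n).1) ke : k <= f x by exact: le_trans (ltW kq) qx.
by apply: (sP n).2; exact: le_trans (ltW (us n)) (le_trans (ltW uk) ke).
Qed.

Let coords_ex q : exists N : set G, ~ cf_omega q -> countable N /\
  forall x y, A x -> A y -> (forall g, N g -> x g = y g) -> (q <= f x <-> q <= f y).
Proof.
have [nom|] := pselect (~ cf_omega q); last by exists set0.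
by have [N Nc NP] := rel_clopen_determined A_supp A_cc (f_clopen_node nom); exists N.
Qed.
Let coords q := sval (cid (coords_ex q)).
Let coordsP q := svalP (cid (coords_ex q)).

Let approx_ex s := countable_approx A s.
Let approx s := s2val (cid2 (approx_ex s)).
Let approx_countable s : countable (approx s) := s2valP (cid2 (approx_ex s)).
Let approxP s := s2valP' (cid2 (approx_ex s)).

Let meet u v := sval (cid (tree_meet treeT completeT u v)).
Let meetP u v := svalP (cid (tree_meet treeT completeT u v)).

Let cofin w := sval (cid (node_sequence treeT w)).
Let cofinP w := svalP (cid (node_sequence treeT w)).

(** A set of coordinates closed under [grow] contains the supports of enough
    points of [A], and the coordinates deciding every wedge needed to tell apart
    the images of two such points. Splitting [s] at [i] makes every pair of lists
    available from their concatenation. *)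
Let grow (s : seq G) : set G :=
  \bigcup_(u in approx s) supp u `|`
  \bigcup_i \bigcup_(u in approx (take i s)) \bigcup_(v in approx (drop i s))
    \bigcup_n coords (cofin (meet (f u) (f v)) n).

Let grow_countable s : countable (grow s).
Proof.
apply: countable_setU.
  apply: bigcup_countable => // u su; apply: A_supp; exact: (approxP s).1.
apply: bigcup_countable => [|i _]; first exact: countableP.
apply: bigcup_countable => // u _; apply: bigcup_countable => // v _.
apply: bigcup_countable => [|n _]; first exact: countableP.
exact: (coordsP ((cofinP _).1 _).1).1.
Qed.

Let grown := hull_closed grow.

(** The nodes whose wedges are decided by the coordinates in a grown [M]; see
    [nodes_coords] and [nodes_separate]. *)
Let nodes (M : set G) : set T := [set t | exists u v s s' n,
  [/\ lists M s, lists M s', approx s u, approx s' v &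
      t = cofin (meet (f u) (f v)) n]].

Let restr_approx M x : grown M -> A x -> exists2 e : nat -> E,
  (forall n, exists2 s, lists M s & approx s (e n)) & e @ \oo --> restr M x.
Proof.
move=> Mcl Ax; pose S := supp x `&` M; pose M' := hull grow S.
have M'M : M' `<=` M by apply: hull_min => // g [].
have Sc : countable S.
  by apply: sub_countable (A_supp Ax); apply: subset_card_le => g [].
have [s [sM' sex]] := countable_exhaustion (countable_hull grow_countable Sc).
have /choice[e eP] n : exists y, approx (s n) y /\
    forall g, g \in s n -> `|y g - x g|%R < (n.+1%:R^-1)%R.
  by have [y sy yx] := (approxP (s n)).2 x n Ax; exists y.
exists e; first by move=> n; exists (s n); [move=> g /sM'/M'M|exact: (eP n).1].
have -> : restr M x = restr M' x.
  apply/funext => g; have [M'g|nM'g] := pselect (M' g).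
    by rewrite !restr_in //; exact: M'M.
  rewrite (restr_out _ nM'g); have [Mg|nMg] := pselect (M g); last exact: restr_out.
  rewrite restr_in //; apply: contrapT => xg; apply: nM'g; apply: sub_hull.
  by split=> //; apply/eqP.
apply: (exhaustion_cvg sex); first by move=> n; exact: (eP n).2.
move=> n g eg; apply: (hull_closed_hull (sM' n)); left.
by exists (e n) => //; exact: (eP n).1.
Qed.

Let approx_sub s x : approx s x -> A x.
Proof. exact: (approxP s).1. Qed.

Let restr_A M x : grown M -> A x -> A (restr M x).
Proof.
move=> Mcl Ax; have [e eP ex] := restr_approx Mcl Ax.
by apply: (seq_closed A_cc _ ex) => n; have [s _ /approx_sub] := eP n.
Qed.

Let nodes_coords M t : grown M -> nodes M t -> ~ cf_omega t /\ coords t `<=` M.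
Proof.
move=> Mcl [u [v [s [s' [n [sM s'M su s'v ->]]]]]].
split; first exact: ((cofinP _).1 n).1.
move=> g tg; apply: (Mcl (s ++ s')).
  by move=> g'; rewrite mem_cat => /orP[/sM|/s'M].
right; exists (size s) => //; exists u; first by rewrite take_size_cat.
by exists v; [rewrite drop_size_cat|exists n].
Qed.

Let nodes_restr M t x : grown M -> nodes M t -> A x -> t <= f x <-> t <= f (restr M x).
Proof.
move=> Mcl /(nodes_coords Mcl)[nom tM] Ax.
apply: (coordsP nom).2 => // [|g /tM Mg]; first exact: restr_A.
by rewrite restr_in.
Qed.

(** The image of a restriction is a limit of images of approximating points. If
    the first image has a node [t0] outside the second, take the least meet [w]
    above [t0] of the images of two approximating points. All later approximating
    images lie above [w], so a node [c] between [t0] and [w] separates the two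
    limits, and the coordinates in [M] decide the wedge of [c]. *)
Let nodes_separate M x y : grown M -> A x -> A y ->
  (forall t, nodes M t -> t <= f x <-> t <= f y) -> f (restr M x) = f (restr M y).
Proof.
move=> Mcl.
suff half x' y' : A x' -> A y' -> (forall t, nodes M t -> t <= f x' <-> t <= f y') ->
    f (restr M x') <= f (restr M y').
  move=> Ax Ay H; apply/le_anti; rewrite half //= half // => t Mt.
  by split=> /(H t Mt).
move=> Ax Ay H; apply: contrapT => /(first_outside treeT completeT).
set a := f (restr M x'); set b := f (restr M y') => -[t0 [t0a t0b nl _]].
have [e eP ex] := restr_approx Mcl Ax.
have Ae n : A (e n) by have [s _ /approx_sub] := eP n.
have ARx := restr_A Mcl Ax.
pose U z := A z -> (t0 <= f z <-> t0 <= a).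
have nU : nbhs (restr M x') U := f_clopen nl ARx.
have [n0 _ n0U] : (e @ \oo) U by exact: ex.
have n0P n : (n0 <= n)%N -> t0 <= f (e n).
  by move=> nn; apply/(n0U n nn (Ae n)).
pose meets w := exists v s, [/\ lists M s, approx s v,
  w = meet (f (e n0)) (f v) & t0 <= w].
have [||w [v [s' [s'M s'v wE t0w]]] wmin] := @tree_least _ _ treeT (f (e n0)) meets.
- by move=> w [v [s [_ _ -> _]]]; have [] := meetP (f (e n0)) (f v).
- have [s sM se] := eP n0; exists (meet (f (e n0)) (f (e n0))), (e n0), s; split=> //.
  by have [_ _] := meetP (f (e n0)) (f (e n0)); apply; exact: (n0P _ (leqnn _)).
have we n : (n0 <= n)%N -> w <= f (e n).
  move=> nn; have [s sM se] := eP n.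
  have [m1 m2 m3] := meetP (f (e n0)) (f (e n)).
  apply: (le_trans _ m2); apply: wmin; exists (e n), s; split=> //.
  by apply: m3; [exact: (n0P _ (leqnn _))|exact: (n0P _ nn)].
have [i /(_ i (leqnn _)) t0c] := (cofinP w).2 t0 (not_limit_nomega treeT nl) t0w.
set c := cofin w i in t0c; have [nomc cw] := (cofinP w).1 i.
have cM : nodes M c.
  by have [s sM se] := eP n0; exists (e n0), v, s, s', i; split; rewrite // /c wE.
have ca : c <= a.
  pose V z := A z -> (c <= f z <-> c <= a).
  have nV : nbhs (restr M x') V := f_clopen_node nomc ARx.
  have [n [/= nn Vn]] : exists n, (n0 <= n)%N /\ V (e n).
    apply: (@filter_ex _ \oo); apply: filterI; first exact: nbhs_infty_ge.
    exact: ex.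
  by apply/(Vn (Ae n)); exact: le_trans cw (we _ nn).
apply: t0b; apply: (le_trans t0c).
by apply/(nodes_restr Mcl cM Ay)/H => //; apply/(nodes_restr Mcl cM Ax).
Qed.

(** The property proved by transfinite induction: the images of the restrictions
    to [M] are told apart by a point-countable family of relatively clopen sets
    that are unions of fibres of [f]. *)
Let good (M : set G) := exists2 F : set (set E),
  (forall S, F S -> rel_clopen A S /\
     forall x y, A x -> A y -> f x = f y -> S x -> S y) &
  (forall x, A x -> countable [set S | F S /\ S x]) /\
  (forall x y, A x -> A y -> (forall S, F S -> S x <-> S y) ->
     f (restr M x) = f (restr M y)).

Let good_countable M : grown M -> countable M -> good M.
Proof.
move=> Mcl Mc; exists ((fun t => [set x | t <= f x]) @` nodes M).
  move=> _ [t Mt <-]; have [nom _] := nodes_coords Mcl Mt.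
  by split; [exact: f_clopen_node|move=> x y _ _ /= ->].
split=> [x Ax|x y Ax Ay H].
  apply: (@sub_countable _ _ _ ((fun t => [set x | t <= f x]) @` nodes M)).
    by apply: subset_card_le => S [].
  apply: countable_image.
  apply: (@sub_countable _ _ _ (\bigcup_(s in lists M) \bigcup_(s' in lists M)
    \bigcup_(u in approx s) \bigcup_(v in approx s') range (cofin (meet (f u) (f v))))).
    apply: subset_card_le => t [u [v [s [s' [n [sM s'M su s'v ->]]]]]].
    by exists s => //; exists s' => //; exists u => //; exists v => //; exists n.
  apply: bigcup_countable => [|s _]; first exact: countable_lists.
  apply: bigcup_countable => [|s' _]; first exact: countable_lists.
  apply: bigcup_countable => // u _; apply: bigcup_countable => // v _.
  by apply: countable_image; exact: countableP.
apply: (nodes_separate Mcl) => // t Mt.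
by apply: (H [set x | t <= f x]); exists t.
Qed.

(** Restrictions to the members of a chain converge to the restriction to its
    union, and [f] is continuous. *)
Let chain_limit (F : set (set G)) x y : F !=set0 -> total_on F subset ->
  (forall M, F M -> grown M) -> A x -> A y ->
  (forall M, F M -> f (restr M x) = f (restr M y)) ->
  f (restr (\bigcup_(M in F) M) x) = f (restr (\bigcup_(M in F) M) y).
Proof.
move=> F0 Ftot Fgrown Ax Ay Fxy; set U := \bigcup_(M in F) M.
have Ugrown : grown U by exact: chain_union_closed.
pose H := filter_from F (fun M => [set M' | F M' /\ M `<=` M']).
have HF : ProperFilter H.
  apply: filter_from_proper; first apply: filter_from_filter => //.
    move=> M M' FM FM'; have [MM'|M'M] := Ftot _ _ FM FM'.
      exists M' => // N [FN M'N]; split; split=> //; exact: subset_trans M'N.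
    exists M => // N [FN MN]; split; split=> //; exact: subset_trans MN.
  by move=> M FM; exists M; split=> // g.
have cvg z : (fun M => restr M z) @ H --> restr U z.
  apply: ptws_cvg => g; have [[M FM Mg]|nUg] := pselect (U g).
    have Ug : U g by exists M.
    apply: cvg_near_cst; exists M => // M' [FM' MM'] /=.
    by rewrite !restr_in //; exact: MM'.
  apply: cvg_near_cst; have [M FM] := F0; exists M => // M' [FM' _] /=.
  by rewrite !restr_out // => M'g; apply: nUg; exists M'.
have FH : H F by have [M FM] := F0; exists M => // M' [].
have near_node q z : ~ limit_height q -> A z ->
    H [set M : set G | F M /\ (q <= f (restr M z) <-> q <= f (restr U z))].
  move=> nl Az; pose V v := A v -> (q <= f v <-> q <= f (restr U z)).
  have nV : nbhs (restr U z) V := f_clopen nl (restr_A Ugrown Az).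
  have HV : H [set M : set G | V (restr M z)] by exact: cvg nV.
  apply: filterS (filterI FH HV) => M [FM VM]; split=> //; apply: VM.
  by apply: restr_A => //; exact: Fgrown.
apply: (eq_nodes treeT completeT) => q nl.
have [M [[FM Mx] [_ My]]] := filter_ex (filterI (near_node q x nl Ax) (near_node q y nl Ay)).
by rewrite -Mx -My (Fxy _ FM).
Qed.

Let restr_restr (M : set G) (x : E) : restr M (restr M x) = restr M x.
Proof.
apply/funext => g; have [Mg|nMg] := pselect (M g); last by rewrite !restr_out.
by rewrite restr_in.
Qed.

Let rel_clopen_restr M S : grown M -> rel_clopen A S -> rel_clopen A [set x | S (restr M x)].
Proof.
move=> Mgr SA x Ax.
have := @restr_continuous R G M x _ (SA _ (restr_A Mgr Ax)).
rewrite /nbhs /=; apply: filterS => y H Ay; apply: H; exact: restr_A.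
Qed.

(** Initial segments of a well-order of the coordinates are enlarged by a
    countable set [C], which can absorb the last element of a segment: the
    induction then never meets a successor step of its own. *)
Section Segments.
Variables (le : rel G) (C : set G).
Hypothesis le_total : forall a b, le a b \/ le b a.
Hypothesis le_anti : forall a b, le a b -> le b a -> a = b.
Hypothesis le_trans : forall a b c, le a b -> le b c -> le a c.
Hypothesis le_least : forall S : set G, S !=set0 ->
  exists2 m, S m & forall s, S s -> le m s.
Hypothesis C_countable : countable C.

Let upto b := hull grow ([set a | le a b] `|` C).

Let stages (D : set G) : set (set G) := [set hull grow C] `|` upto @` D.

Let stages_grown D M : stages D M -> grown M.
Proof. by move=> [->|[b _ <-]]; exact: hull_closed_hull. Qed.

Let le_refl a : le a a.
Proof. by have [] := le_total a a. Qed.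

Let stages_total D : total_on (stages D) subset.
Proof.
move=> M M' [->|[b Db <-]] [->|[b' Db' <-]].
- by left.
- by left; apply: hull_mono => a; right.
- by right; apply: hull_mono => a; right.
- have [bb'|b'b] := le_total b b'; [left|right]; apply: hull_mono => a [ab|];
    by [left; exact: le_trans ab _|right].
Qed.

Let stages_union D : (forall a b, D b -> le a b -> D a) ->
  hull grow (D `|` C) = \bigcup_(M in stages D) M.
Proof.
move=> Ddown; apply/seteqP; split; last first.
  move=> g [M [->|[b Db <-]]]; apply: hull_mono => a; first by right.
  by move=> [ab|Ca]; [left; exact: Ddown ab|right].
apply: hull_min; first apply: chain_union_closed.
- by exists (hull grow C); left.
- exact: stages_total.
- exact: stages_grown.
move=> a [Da|Ca].
  by exists (upto a); [right; exists a|apply: sub_hull; left; exact: le_refl].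
by exists (hull grow C); [left|exact: sub_hull].
Qed.

(** Take the family of the starting stage together with, for each [b] in [D], the
    points at which membership in a set of the family of stage [b] changes between
    the restrictions to [below b] and to [upto b]. A point has countable support,
    so its restriction moves at only countably many stages. Agreement on all these
    sets propagates from stage to stage, through [chain_limit] at the limits. *)
Lemma good_step D : (forall a b, D b -> le a b -> D a) ->
  (forall b, D b -> good (upto b)) -> good (hull grow (D `|` C)).
Proof.
move=> Ddown Dgood.
pose below b := hull grow ([set a | le a b /\ a <> b] `|` C).
have below_grown b : grown (below b) by exact: hull_closed_hull.
have upto_grown b : grown (upto b) by exact: hull_closed_hull.
have [F0 F0clopen [F0count F0sep]] : good (hull grow C).
  by apply: good_countable; [exact: hull_closed_hull|exact: countable_hull].
have /choice[F FP] b : exists F : set (set E), D b -> [/\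
  forall S, F S -> rel_clopen A S,
  forall S, F S -> forall x y, A x -> A y -> f x = f y -> S x -> S y,
  forall x, A x -> countable [set S | F S /\ S x] &
  forall x y, A x -> A y -> (forall S, F S -> S x <-> S y) ->
     f (restr (upto b) x) = f (restr (upto b) y)].
  have [Db|] := pselect (D b); last by exists set0.
  have [F Fclopen [Fcount Fsep]] := Dgood b Db; exists F => _; split=> //.
    by move=> S /Fclopen[].
  by move=> S /Fclopen[].
have restr_eq M x y : grown M -> A x -> A y -> f x = f y -> f (restr M x) = f (restr M y).
  move=> Mgr Ax Ay fxy; apply: nodes_separate => // t _; by rewrite fxy.
pose up b (S : set E) := [set x | S (restr (upto b) x) /\ ~ S (restr (below b) x)].
pose down b (S : set E) := [set x | S (restr (below b) x) /\ ~ S (restr (upto b) x)].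
exists (F0 `|` \bigcup_(b in D) (up b @` F b `|` down b @` F b)).
  move=> S [F0S|[b Db]]; first exact: F0clopen.
  have [Fclopen Fsat _ _] := FP b Db.
  have sat S' x y M : F b S' -> grown M -> A x -> A y -> f x = f y ->
      S' (restr M x) -> S' (restr M y).
    by move=> FS' Mgr Ax Ay fxy; apply: Fsat => //; [exact: restr_A|exact: restr_A|exact: restr_eq].
  have cut S' M M' : F b S' -> grown M -> grown M' ->
      rel_clopen A [set x | S' (restr M x) /\ ~ S' (restr M' x)] /\
      forall x y, A x -> A y -> f x = f y ->
        S' (restr M x) /\ ~ S' (restr M' x) -> S' (restr M y) /\ ~ S' (restr M' y).
    move=> FS' Mgr M'gr; split.
      apply: rel_clopenI; last apply: rel_clopenC;
        by apply: rel_clopen_restr => //; exact: Fclopen.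
    move=> x y Ax Ay fxy [S1 S2]; split; first exact: sat S1.
    by move=> S3; apply: S2; exact: sat (esym fxy) S3.
  by move=> [[S' FS' <-]|[S' FS' <-]]; exact: cut.
split=> [x Ax|x y Ax Ay agree].
  pose moved := [set b | D b /\ restr (upto b) x <> restr (below b) x].
  have moved_countable : countable moved.
    apply: (@sub_countable _ _ _ (\bigcup_(g in supp x) [set b | upto b g /\ ~ below b g])).
      apply: subset_card_le => b [_ ne]; apply: contrapT => H; apply: ne.
      apply/funext => g; have [ug|nug] := pselect (upto b g); last first.
        rewrite !restr_out // => bg; apply: nug; move: g bg; apply: hull_mono => a.
        by move=> [[ab _]|Ca]; [left|right].
      have [bg|nbg] := pselect (below b g); first by rewrite !restr_in.
      rewrite (restr_in _ ug) (restr_out _ nbg); apply: contrapT => xg; apply: H.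
      by exists g => //; apply/eqP.
    apply: bigcup_countable => [|g _]; first exact: A_supp.
    have [[b0 [ub0 nb0]]|none] := pselect (exists b, upto b g /\ ~ below b g); last first.
      rewrite (_ : [set b | _] = set0); first exact: countable0.
      by apply/seteqP; split=> // b H; apply: none; exists b.
    apply: (@sub_countable _ _ _ [set b0]); last exact: countable1.
    have early a b : le a b -> a <> b -> upto a `<=` below b.
      move=> ab nab; apply: hull_mono => c [ca|Cc]; [left|by right].
      split; first exact: le_trans ca ab.
      by move=> cb; apply: nab; apply: le_anti => //; rewrite -cb.
    apply: subset_card_le => b [ub nb] /=; apply: contrapT => ne.
    have [bb0|b0b] := le_total b b0; [apply: nb0|apply: nb].
      exact: early ub.
    by apply: early ub0 => // /esym.
  apply: (@sub_countable _ _ _ ([set S | F0 S /\ S x] `|` \bigcup_(b in moved)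
    (up b @` [set S | F b S /\ S (restr (upto b) x)] `|`
     down b @` [set S | F b S /\ S (restr (below b) x)]))).
    apply: subset_card_le => S [[F0S|[b Db [[S' FS' <-]|[S' FS' <-]]]]].
    - by move=> Sx; left.
    - move=> [S1 S2]; right; exists b; last by left; exists S'.
      by split=> // e; apply: S2; rewrite -e.
    - move=> [S1 S2]; right; exists b; last by right; exists S'.
      by split=> // e; apply: S2; rewrite e.
  apply: countable_setU; first exact: F0count.
  apply: bigcup_countable => // b [Db _]; have [_ _ Fcount _] := FP b Db.
  by apply: countable_setU; apply: countable_image;
     apply: Fcount; exact: restr_A.
have f_base : f (restr (hull grow C) x) = f (restr (hull grow C) y).
  by apply: F0sep => // S F0S; apply: agree; left.
have union_eq D' : (forall a b, D' b -> le a b -> D' a) ->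
    (forall b, D' b -> f (restr (upto b) x) = f (restr (upto b) y)) ->
    f (restr (hull grow (D' `|` C)) x) = f (restr (hull grow (D' `|` C)) y).
  move=> D'down D'eq; rewrite (stages_union D'down); apply: chain_limit => //.
  - by exists (hull grow C); left.
  - exact: stages_grown.
  - by move=> M [->|[b D'b <-]]; [exact: f_base|exact: D'eq].
apply: (union_eq D Ddown) => b Db; apply: contrapT => bad.
have [|m [Dm mbad] mleast] := @le_least [set b | D b /\ f (restr (upto b) x) <> f (restr (upto b) y)].
  by exists b.
have [_ Fsat _ Fsep] := FP m Dm.
have eq_below : f (restr (below m) x) = f (restr (below m) y).
  apply: (union_eq [set a | le a m /\ a <> m]) => [a b' [b'm nb'm] ab'|a [am nam]].
    split; first exact: le_trans ab' b'm.
    by move=> am; apply: nb'm; apply: le_anti => //; rewrite -am.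
  apply: contrapT => abad; apply: nam; apply: le_anti => //.
  by apply: mleast; split=> //; exact: Ddown am.
apply: mbad; rewrite -(restr_restr (upto m) x) -(restr_restr (upto m) y).
apply: Fsep; [exact: restr_A|exact: restr_A|move=> S FS].
have S_below : S (restr (below m) x) <-> S (restr (below m) y).
  by split; apply: Fsat => //; exact: restr_A.
have [up_agree down_agree] : (up m S x <-> up m S y) /\ (down m S x <-> down m S y).
  by split; apply: agree; right; exists m => //; [left|right]; exists S.
have [Sb|nSb] := pselect (S (restr (below m) x)).
  have [Sby _] := S_below; have {}Sby := Sby Sb.
  split=> Su; apply: contrapT => nSu.
    by have [_ /(_ (conj Sby nSu))[]] := down_agree.
  by have [/(_ (conj Sb nSu))[]] := down_agree.
have nSby : ~ S (restr (below m) y) by move=> /S_below.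
split=> Su.
  by have [/(_ (conj Su nSb))[]] := up_agree.
by have [_ /(_ (conj Su nSby))[]] := up_agree.
Qed.

End Segments.

(** At the least [m] for which some enlarged segment fails, moving [m] into the
    countable part leaves a segment all of whose stages are good, contradicting
    [good_step]. *)
Lemma restriction_family : exists2 F : set (set E),
  (forall S, F S -> rel_clopen A S /\
     forall x y, A x -> A y -> f x = f y -> S x -> S y) &
  (forall x, A x -> countable [set S | F S /\ S x]) /\
  (forall x y, A x -> A y -> (forall S, F S -> S x <-> S y) -> f x = f y).
Proof.
have [le [le_total le_anti le_trans le_least]] := exists_well_order G.
have segments b C : countable C -> good (hull grow ([set a | le a b] `|` C)).
  move=> Cc; apply: contrapT => bad.
  have [|m [C' C'c mbad] mleast] := le_least
      [set b | exists2 C, countable C & ~ good (hull grow ([set a | le a b] `|` C))].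
    by exists b, C.
  apply: mbad.
  have -> : ([set a | le a m] `|` C' = [set a | le a m /\ a <> m] `|` (C' `|` [set m]))%classic.
    apply/seteqP; split=> a.
      move=> [am|C'a]; last by right; left.
      by have [->|/eqP am'] := eqVneq a m; [right; right|left].
    move=> [[am _]|[C'a|->]]; [by left|by right|left].
    by have [] := le_total m m.
  have C''c : countable (C' `|` [set m])%classic by apply: countable_setU => //; exact: countable1.
  apply: (good_step le_total le_anti le_trans le_least C''c) => [a b' [b'm nb'm] ab'|b' [b'm nb'm]].
    split; first exact: le_trans ab' b'm.
    by move=> am; apply: nb'm; apply: le_anti => //; rewrite -am.
  apply: contrapT => b'bad; apply: nb'm; apply: le_anti => //.
  by apply: mleast; exists (C' `|` [set m])%classic.
have [F Fclopen [Fcount Fsep]] : good (hull grow (setT `|` set0)).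
  apply: (good_step le_total le_anti le_trans le_least) => //.
  by move=> b _; apply: segments; exact: countable0.
exists F => //; split=> // x y Ax Ay agree.
have full (z : E) : restr (hull grow (setT `|` set0)) z = z.
  by apply: restr_id => g _; apply: sub_hull; left.
by rewrite -(full x) -(full y); exact: Fsep.
Qed.

End RestrictionFamily.

(** * From weakly Corson to Corson countably compact *)

Section WeaklyCorsonCorson.
Context {R : realType} {d : Order.disp_t} {T : porderType d}.
Hypothesis treeT : is_tree T.
Hypothesis completeT : chain_complete T.

Section Image.
Context {G : choiceType} (A : set {ptws G -> R}) (f : {ptws G -> R} -> T).
Hypothesis A_supp : forall x, A x -> countable (supp x).
Hypothesis A_cc : countably_compact A.
Hypothesis f_clopen : forall q, ~ limit_height q -> rel_clopen A [set x | q <= f x].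
Hypothesis f_onto : forall t, exists2 x, A x & f x = t.

Let f_node q : ~ cf_omega q -> rel_clopen A [set x | q <= f x].
Proof. exact: (f_clopen_node treeT completeT A_supp f_clopen). Qed.

(** The indicators of the images of the sets in a [restriction_family] embed [T]
    into a Sigma-product. Both directions of continuity are checked on sequences:
    a sequence in [T] lifts to [A], where it clusters, and both topologies
    involved are Frechet. *)
Lemma image_corson : corson_countably_compact R (sigma_coarse_wedge T).
Proof.
have [F F_clopen [F_count F_sep]] :=
  restriction_family treeT completeT A_supp A_cc f_clopen.
pose I : choiceType := set {ptws G -> R}.
pose mem_f t (S : I) := F S /\ exists x, [/\ A x, f x = t & S x].
pose g (t : T) : {ptws I -> R} := fun S => if `[< mem_f t S >] then 1%R else 0%R.
have mem_fP x S : A x -> mem_f (f x) S <-> F S /\ S x.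
  move=> Ax; split=> [[FS [y [Ay fy Sy]]]|[FS Sx]]; split=> //; last by exists x.
  exact: ((F_clopen S FS).2 y x).
have g_eq s t S : (mem_f s S <-> mem_f t S) -> g s S = g t S.
  move=> st; rewrite /g; congr (if _ then _ else _).
  by apply/asboolP/asboolP => /st.
have eq_g s t S : g s S = g t S -> mem_f s S -> mem_f t S.
  rewrite /g => + sS; rewrite (asboolT sS); case: asboolP => // _ /eqP.
  by rewrite oner_eq0.
have g_supp t : countable (supp (g t)).
  have [x Ax <-] := f_onto t.
  apply: sub_countable (F_count x Ax); apply: subset_card_le => S.
  by rewrite /supp /g /=; case: asboolP => [/(mem_fP _ _ Ax)//|_]; rewrite eqxx.
have g_inj s t : g s = g t -> s = t.
  have [x Ax <-] := f_onto s; have [y Ay <-] := f_onto t => gst.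
  apply: F_sep => // S FS; split=> [Sx|Sy].
    have /(mem_fP _ _ Ay)[] // : mem_f (f y) S.
    by apply: (@eq_g (f x)); [rewrite gst|exact/(mem_fP _ _ Ax)].
  have /(mem_fP _ _ Ax)[] // : mem_f (f x) S.
  by apply: (@eq_g (f y)); [rewrite gst|exact/(mem_fP _ _ Ay)].
have gf_near (H : set_system nat) (e : nat -> {ptws G -> R}) x S : ProperFilter H ->
    (forall n, A (e n)) -> A x -> e @ H --> x -> H [set n | g (f (e n)) S = g (f x) S].
  move=> HH Ae Ax ex; have [FS|nFS] := pselect (F S); last first.
    by apply: filterE => n; apply: g_eq; split=> -[].
  pose V y := A y -> (S y <-> S x).
  have nV : nbhs x V := (F_clopen S FS).1 x Ax.
  have HV : H [set n | V (e n)] by exact: ex.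
  apply: filterS HV => n VS; apply: g_eq; split=> /mem_fP[]// _ h;
    by apply/mem_fP => //; split=> //; apply/(VS (Ae n)).
have gf_cvg (H : set_system nat) (e : nat -> {ptws G -> R}) x : ProperFilter H ->
    (forall n, A (e n)) -> A x -> e @ H --> x -> (fun n => g (f (e n))) @ H --> g (f x).
  by move=> HH Ae Ax ex; apply: ptws_cvg => S; apply: cvg_near_cst; exact: gf_near.
have node_near (H : set_system nat) (e : nat -> {ptws G -> R}) x q : ProperFilter H ->
    ~ cf_omega q -> (forall n, A (e n)) -> A x -> e @ H --> x ->
    H [set n | q <= f (e n) <-> q <= f x].
  move=> HH nom Ae Ax ex; pose V y := A y -> (q <= f y <-> q <= f x).
  have nV : nbhs x V := f_node nom Ax.
  have HV : H [set n | V (e n)] by exact: ex.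
  by apply: filterS HV => n; exact.
(* a sequence in T lifts to A and converges there along a filter H *)
have lift (t : nat -> T) : exists e x H, [/\ forall n, A (e n) /\ f (e n) = t n, A x,
    ProperFilter H, forall n, H [set m | (n <= m)%N] & e @ H --> x].
  have /choice[e eP] n : exists x, A x /\ f x = t n.
    by have [x Ax fx] := f_onto (t n); exists x.
  have [x Ax [H [HH Hn ex]]] := countably_compact_sublimit A_cc (fun n => (eP n).1).
  by exists e, x, H.
have g_cont : continuous (g : sigma_coarse_wedge T -> {ptws I -> R}).
  move=> p; apply: (@ptws_cvg _ _ _ _ _ _ (nbhs_filter (p : sigma_coarse_wedge T))) => S.
  apply: cvg_near_cst; apply: contrapT => nnear.
  have [|t tS tp] := @sigma_closure_seq d T treeT [set t | g t S <> g p S] p.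
    move=> U pU; apply: contrapT => none; apply: nnear.
    apply: filterS pU => t Ut; apply: contrapT => ne; apply: none.
    by exists t; split=> // e; apply: ne; rewrite e.
  have [e [x [H [eP Ax HH Hn ex]]]] := lift t.
  have Ae n : A (e n) := (eP n).1.
  have fxp : f x = p.
    apply: (eq_nodes treeT completeT) => q nl; have nom := not_limit_nomega treeT nl.
    have near_q := node_near H e x q HH nom Ae Ax ex.
    have [inq outq] := tp q nom; split=> [qx|qp].
      apply: contrapT => /outq[n nP].
      have [m [/= [_ /(_ qx)] qm nm]] := filter_ex (filterI near_q (Hn n)).
      by apply: (nP m nm); rewrite -(eP m).2.
    have [n nP] := inq qp.
    have [m [/= [qm _] nm]] := filter_ex (filterI near_q (Hn n)).
    by apply: qm; rewrite (eP m).2; exact: nP.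
  have [n /= gn] := filter_ex (gf_near H e x S HH Ae Ax ex).
  by apply: (tS n); rewrite -fxp -(eP n).2.
have gY t : range g (g t) by exists t.
have /choice[k kP] (c : set_type (range g)) : exists t, g t = set_val c.
  by have [t _ gt] : range g (set_val c) := set_valP c; exists t.
exists I, (range g); split.
- move=> _ [t _ <-]; split; last exact: g_supp.
  by move=> S; rewrite /g; case: ifP; rewrite ?lexx ?ler01.
- apply: sublimit_countably_compact => y yY.
  have /choice[t tP] n : exists t, g t = y n by have [t _ <-] := yY n; exists t.
  have [e [x [H [eP Ax HH Hn ex]]]] := lift t.
  exists (g (f x)) => //; exists H; split=> //.
  have -> : y = (fun n => g (f (e n))) by apply/funext => n; rewrite (eP n).2.
  by apply: gf_cvg => // n; exact: (eP n).1.
- exists (fun t => SigSub (mem_set (gY t))), k; split.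
  + by move=> t; apply: g_inj; rewrite kP.
  + by move=> c; apply: val_inj => /=; rewrite kP.
  + move=> p U /set_type_nbhsP[W pW WU].
    have : nbhs (p : sigma_coarse_wedge T) (g @^-1` W) by exact: g_cont.
    by apply: filterS => t Wt; exact: WU.
  move=> c; have FF : Filter (k @ nbhs c) by exact: fmap_filter.
  have near_q q : ~ cf_omega q -> nbhs c [set c' | q <= k c' <-> q <= k c].
    move=> nom; apply: contrapT => nnear.
    have [|||y yP yc] := @sigma_frechet R I
      (g @` [set t | ~ (q <= t <-> q <= k c)]) (g (k c)).
    - by move=> _ [t _ <-]; exact: g_supp.
    - exact: g_supp.
    - move=> U cU; apply: contrapT => none; apply: nnear; apply/set_type_nbhsP.
      exists U; first by rewrite -kP.
      move=> c' Uc'; apply: contrapT => ne; apply: none.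
      by exists (g (k c')); split; [exists (k c')|rewrite kP].
    have /choice[t tP] n : exists t, ~ (q <= t <-> q <= k c) /\ g t = y n.
      by have [t nt gt] := yP n; exists t.
    have [e [x [H [eP Ax HH Hn ex]]]] := lift t.
    have Ae n : A (e n) := (eP n).1.
    have yH : y @ H --> g (k c).
      apply: cvg_trans yc; apply: cvg_app => B [n _ nB].
      by apply: filterS (Hn n) => m /nB.
    have yx : y @ H --> g (f x).
      have -> : y = (fun n => g (f (e n))).
        by apply/funext => n; rewrite (eP n).2 (tP n).2.
      exact: gf_cvg.
    have fx : f x = k c.
      by apply: g_inj; apply: (@cvg_unique _ (@ptws_hausdorff R I) (y @ H)).
    have [n /= qn] := filter_ex (node_near H e x q HH nom Ae Ax ex).
    by apply: (tP n).1; rewrite -(eP n).2 -fx.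
  apply: (sigma_wedge_cvg FF) => q nom qc.
    by apply: filterS (near_q q nom) => c' [_]; exact.
  apply: filterS (near_q q nom) => c' [H _].
  by have nH : ~ q <= k c' by move=> /H.
Qed.

End Image.

Hypothesis rootedT : rooted T.

Lemma weakly_corson_corson : weakly_corson_compact R (coarse_wedge T) ->
  corson_countably_compact R (sigma_coarse_wedge T).
Proof.
move=> [_ _ [L [f [[G]]]]]; elim/Pchoice: G => G [A [A_Sigma A_cc]].
move=> [a [b [aK bK a_cont b_cont]]] f_cont f_onto.
have [r _] := tree_root treeT rootedT.
(* f is transported to a total function; its value r off A is arbitrary *)
pose F (x : {ptws G -> R}) : T :=
  if pselect (A x) is left Ax then f (b (SigSub (mem_set Ax))) else r.
have FE (c : set_type A) : F (set_val c) = f (b c).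
  rewrite /F; case: pselect => [Ac|/(_ (set_valP c))//].
  by congr (f (b _)); exact: val_inj.
apply: (@image_corson G A F).
- by move=> x /A_Sigma[].
- exact: A_cc.
- move=> q nl x Ax; have qf := (tree_cf_finiteP treeT q).2 nl.
  pose c : set_type A := SigSub (mem_set Ax).
  have xc : x = set_val c by [].
  have fb_cont : continuous (f \o b : set_type A -> coarse_wedge T).
    by move=> c'; apply: continuous_comp; [exact: b_cont|exact: f_cont].
  have side (Q : set T) : open (Q : set (coarse_wedge T)) -> Q (f (b c)) ->
      \forall y \near x, A y -> Q (F y).
    move=> Qo Qc; have /set_type_nbhsP[W xW WQ] : nbhs c ((f \o b) @^-1` Q).
      by apply: fb_cont; exact: open_nbhs_nbhs.
    apply: filterS xW => y Wy Ay; have -> : y = set_val (SigSub (mem_set Ay) : set_type A) by [].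
    by rewrite FE; exact: WQ.
  rewrite xc; have [qc|nqc] := pselect (q <= F x).
    apply: filterS (side (wedge q) (wedge_open qf) _) => [y H Ay|]; last by rewrite -FE.
    by split=> // _; exact: H.
  apply: filterS (side (~` wedge q) (wedgeC_open qf) _) => [y H Ay|]; last by rewrite -FE.
  by split=> // qy; exfalso; exact: (H Ay).
- move=> t; have [l _ <-] : range f t by rewrite f_onto.
  by exists (set_val (a l)); [exact: set_valP|rewrite FE aK].
Qed.

End WeaklyCorsonCorson.

Theorem theorem4p2 (R : realType) (d : Order.disp_t) (T : porderType d)
    (treeT : is_tree T) (rootedT : rooted T)
    (chain_completeT : chain_complete T) :
  [<-> weakly_corson_compact R (coarse_wedge T);
       corson_countably_compact R (sigma_coarse_wedge T);
       valdivia_compact R (coarse_wedge (hat T))].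
Proof.
tfae.
- exact: weakly_corson_corson.
- exact: corson_valdivia.
- exact: valdivia_weakly_corson.
Qed.
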